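(* Consider the problem of minimizing $\varphi(x)$ over $x\in\mathbb{R}^n$ subject to $f(x)\in\Theta$, where $\Theta\subset\mathbb{R}^m$ is a closed convex set, and $\varphi:\mathbb{R}^n\to\mathbb{R}$ and $f:\mathbb{R}^n\to\mathbb{R}^m$ are twice differentiable at a feasible point $\bar x$ (i.e. $f(\bar x)\in\Theta$). Let $\Omega=\{x\in\mathbb{R}^n:f(x)\in\Theta\}$, $\bar v:=-\nabla\varphi(\bar x)$, $L(x,\lambda)=\varphi(x)+\langle\lambda,f(x)\rangle$, and $\Lambda(\bar x,\bar v)=\{\lambda\in N_\Theta(f(\bar x)):\nabla f(\bar x)^*\lambda=\bar v\}$. Suppose that: - $\bar v\in N_\Omega(\bar x)$; - there are $\kappa>0$ and a neighborhood $U$ of $\bar x$ with $\operatorname{dist}(x;\Omega)\le\kappa\operatorname{dist}(f(x);\Theta)$ for all $x\in U$; - for every $\bar\lambda\in\Lambda(\bar x,\bar v)$ the set $\Theta$ is parabolically derivable at $f(\bar x)$ for all vectors of the form $\nabla f(\bar x)w$ that lie in $K_\Theta(f(\bar x),\bar\lambda)$; - $\Theta$ is parabolically regular at $f(\bar x)$ for every $\lambda\in\Lambda(\bar x,\bar v)$. Then: (i) If $\bar x$ is a local minimizer of the problem, then $$\max_{\lambda\in\Lambda(\bar x,\bar v)}\big\{\langle\nabla^2_{xx}L(\bar x,\lambda)w,w\rangle+\mathrm{d}^2\delta_\Theta(f(\bar x),\lambda)(\nabla f(\bar x)w)\big\}\ge0\quad\text{for all }w\in K_\Omega(\bar x,\bar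 v).$$ (ii) The condition $$\max_{\lambda\in\Lambda(\bar x,\bar v)}\big\{\langle\nabla^2_{xx}L(\bar x,\lambda)w,w\rangle+\mathrm{d}^2\delta_\Theta(f(\bar x),\lambda)(\nabla f(\bar x)w)\big\}>0\quad\text{for all }w\in K_\Omega(\bar x,\bar v)\setminus\{0\}$$ is equivalent to the existence of constants $\ell>0$ and $\varepsilon>0$ such that $$\psi(x)\ge\psi(\bar x)+\tfrac{\ell}{2}\|x-\bar x\|^2\quad\text{for all }x\in\mathbb{B}_\varepsilon(\bar x),$$ where $\psi:=\varphi+\delta_\Theta\circ f$. Thus, under this condition, $\bar x$ is a strict local minimizer of the problem.
   Context: $\mathbb{B}_\varepsilon(\bar x)$ is the closed ball of radius $\varepsilon$ about $\bar x$; $\delta_\Omega$ is the indicator function of $\Omega$. Tangent cone: $T_\Omega(\bar x)=\{w:\exists t_k\downarrow0,\ w_k\to w,\ \bar x+t_kw_k\in\Omega\}$. Regular normal cone: $\widehat N_\Omega(\bar x)=\{v:\limsup_{x\to\bar x,\,x\in\Omega,\,x\neq\bar x}\frac{\langle v,x-\bar x\rangle}{\|x-\bar x\|}\le0\}$. Limiting normal cone: $N_\Omega(\bar x)=\{v:\exists x_k\to\bar x,\ x_k\in\Omega,\ v_k\to v,\ v_k\in\widehat N_\Omega(x_k)\}$ (for convex sets this is the normal cone of convex analysis). Critical cone for $\bar v\in N_\Omega(\bar x)$: $K_\Omega(\bar x,\bar v)=T_\Omega(\bar x)\cap\{\bar v\}^\perp$. Second-order tangent set: $T^2_\Omega(\bar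 x,w)=\{u:\exists t_k\downarrow0,\ u_k\to u,\ \bar x+t_kw+\tfrac12t_k^2u_k\in\Omega\}$. $\Omega$ is parabolically derivable at $\bar x$ for $w$ if $T^2_\Omega(\bar x,w)\ne\emptyset$ and for each $u\in T^2_\Omega(\bar x,w)$ there are $\varepsilon>0$ and an arc $\xi:[0,\varepsilon]\to\Omega$ with $\xi(0)=\bar x$, $\xi'_+(0)=w$ and $\xi''_+(0):=\lim_{t\downarrow0}\frac{\xi(t)-\xi(0)-t\xi'_+(0)}{\frac12t^2}=u$. Second-order difference quotients: $\Delta_t^2\varphi(\bar x,\bar v)(u)=\frac{\varphi(\bar x+tu)-\varphi(\bar x)-t\langle\bar v,u\rangle}{\frac12t^2}$, $t>0$. Second subderivative: $\mathrm{d}^2\varphi(\bar x,\bar v)(w)=\liminf_{t\downarrow0,\,u\to w}\Delta_t^2\varphi(\bar x,\bar v)(u)$. $\Omega$ is parabolically regular at $\bar x\in\Omega$ for $\bar v$ if for every $w$ with $\mathrm{d}^2\delta_\Omega(\bar x,\bar v)(w)<\infty$ there exist sequences $t_k\downarrow0$, $w_k\to w$ with $\Delta^2_{t_k}\delta_\Omega(\bar x,\bar v)(w_k)\to\mathrm{d}^2\delta_\Omega(\bar x,\bar v)(w)$ and $\limsup_{k\to\infty}\|w_k-w\|/t_k<\infty$. *)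

(* Defs.v *)
From HB Require Import structures.
From mathcomp Require Import all_boot all_order all_algebra.
From mathcomp Require Import all_classical all_reals all_analysis.

Set Implicit Arguments.
Unset Strict Implicit.
Unset Printing Implicit Defensive.

Import Order.TTheory GRing.Theory Num.Theory.
Import numFieldNormedType.Exports.

Local Open Scope classical_set_scope.
Local Open Scope ring_scope.

(* Vectors of R^n are row vectors 'rV[R]_n.  The library norm `|x| on 'rV[R]_n
   is the sup norm; it induces the usual topology, but every quantity that
   refers to the norm of R^n is stated with the Euclidean norm [enorm]. *)

Section Euclidean.
Context {R : realType} {n : nat}.
Implicit Types (x u v : 'rV[R]_n) (A : set 'rV[R]_n).

Definition dot u v : R := \sum_(i < n) u 0 i * v 0 i.

Definition enorm x : R := Num.sqrt (dot x x).

Definition edistance x A : R := inf [set enorm (x - y) | y in A].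

Definition indicator A x : \bar R := if x \in A then 0%E else +oo%E.

End Euclidean.

Section VariationalGeometry.
Context {R : realType} {n : nat}.
Implicit Types (A : set 'rV[R]_n) (x u v w : 'rV[R]_n).

Definition tangent_cone A x : set 'rV[R]_n :=
  [set w | exists (t : nat -> R) (w_ : nat -> 'rV[R]_n),
     [/\ forall k, 0 < t k, t @ \oo --> 0, w_ @ \oo --> w &
         forall k, A (x + t k *: w_ k)]].

(* If x is isolated in A, the filter below is improper and the limsup is -oo. *)
Definition regular_normal_cone A x : set 'rV[R]_n :=
  [set v | (limf_esup (fun y : 'rV[R]_n => (dot v (y - x) / enorm (y - x))%:E)
              (within A x^') <= 0)%E].

Definition normal_cone A x : set 'rV[R]_n :=
  [set v | exists (x_ v_ : nat -> 'rV[R]_n),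
     [/\ x_ @ \oo --> x, forall k, A (x_ k), v_ @ \oo --> v &
         forall k, regular_normal_cone A (x_ k) (v_ k)]].

Definition critical_cone A x v : set 'rV[R]_n :=
  tangent_cone A x `&` [set w | dot v w = 0].

Definition second_order_tangent_set A x w : set 'rV[R]_n :=
  [set u | exists (t : nat -> R) (u_ : nat -> 'rV[R]_n),
     [/\ forall k, 0 < t k, t @ \oo --> 0, u_ @ \oo --> u &
         forall k, A (x + t k *: w + (2^-1 * t k ^+ 2) *: u_ k)]].

Definition parabolically_derivable A x w : Prop :=
  second_order_tangent_set A x w !=set0 /\
  forall u, second_order_tangent_set A x w u ->
    exists2 eps : R, 0 < eps & exists xi : R -> 'rV[R]_n,
      [/\ forall t : R, 0 <= t <= eps -> A (xi t),
          xi 0 = x,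
          t^-1 *: (xi t - xi 0) @[t --> 0^'+] --> w &
          (2^-1 * t ^+ 2)^-1 *: (xi t - xi 0 - t *: w) @[t --> 0^'+] --> u].

Definition diff_quotient2 (phi : 'rV[R]_n -> \bar R) x v (t : R) u : \bar R :=
  ((phi (x + t *: u)%R - phi x - (t * dot v u)%:E)
     * ((2^-1 * t ^+ 2)^-1)%:E)%E.

Definition second_subderivative (phi : 'rV[R]_n -> \bar R) x v w : \bar R :=
  limf_einf (fun p : R * 'rV[R]_n => diff_quotient2 phi x v p.1 p.2)
    (filter_prod 0^'+ (nbhs w)).

Definition parabolically_regular A x v : Prop :=
  forall w, (second_subderivative (indicator A) x v w < +oo)%E ->
    exists (t : nat -> R) (w_ : nat -> 'rV[R]_n),
      [/\ forall k, 0 < t k, t @ \oo --> 0, w_ @ \oo --> w,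
          diff_quotient2 (indicator A) x v (t k) (w_ k) @[k --> \oo]
            --> second_subderivative (indicator A) x v w &
          (limn_esup (fun k => (enorm (w_ k - w) / t k)%:E) < +oo)%E].

End VariationalGeometry.

Section Derivatives.
Context {R : realType} {n : nat}.

Definition grad (phi : 'rV[R]_n -> R) (x : 'rV[R]_n) : 'rV[R]_n :=
  \row_i 'd phi x (delta_mx 0 i).

Definition hess (phi : 'rV[R]_n -> R) (x : 'rV[R]_n) : 'M[R]_n :=
  jacobian (grad phi) x.

(* Classical (Frechet) twice differentiability at a point: differentiable on a
   neighborhood of it, with a derivative that is differentiable at it. *)
Definition twice_differentiable (phi : 'rV[R]_n -> R) (x : 'rV[R]_n) : Prop :=
  (\forall y \near x, differentiable phi y) /\ differentiable (grad phi) x.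

Definition twice_differentiable_map (m : nat) (f : 'rV[R]_n -> 'rV[R]_m)
    (x : 'rV[R]_n) : Prop :=
  (\forall y \near x, differentiable f y) /\ differentiable (jacobian f) x.

End Derivatives.

Section ConstrainedProblem.
Context {R : realType} {n m : nat}.
Variables (phi : 'rV[R]_n -> R) (f : 'rV[R]_n -> 'rV[R]_m).
Variable Theta : set 'rV[R]_m.
Implicit Types (xbar vbar w : 'rV[R]_n) (lam : 'rV[R]_m).

Definition feasible_set : set 'rV[R]_n := f @^-1` Theta.

Definition Lagrangian (x : 'rV[R]_n) lam : R := phi x + dot lam (f x).

Definition objective (x : 'rV[R]_n) : \bar R :=
  ((phi x)%:E + indicator Theta (f x))%E.

(* In the row-vector convention, the derivative of f at xbar maps w to
   w *m jacobian f xbar, so that its adjoint is multiplication by the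
   transposed Jacobian. *)
Definition multipliers xbar vbar : set 'rV[R]_m :=
  [set lam | normal_cone Theta (f xbar) lam /\
             lam *m (jacobian f xbar)^T = vbar].

Definition second_order_term xbar w lam : \bar R :=
  ((dot (w *m hess (fun x => Lagrangian x lam) xbar) w)%:E
   + second_subderivative (indicator Theta) (f xbar) lam
       (w *m jacobian f xbar))%E.

Definition metric_subregularity_condition xbar : Prop :=
  exists2 kappa : R, 0 < kappa &
    \forall x \near xbar,
      edistance x feasible_set <= kappa * edistance (f x) Theta.

Definition local_minimizer xbar : Prop :=
  feasible_set xbar /\
  \forall x \near xbar, feasible_set x -> phi xbar <= phi x.

Definition strict_local_minimizer xbar : Prop :=
  feasible_set xbar /\
  \forall x \near xbar, feasible_set x -> x != xbar -> phi xbar < phi x.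

Definition quadratic_growth xbar : Prop :=
  exists l eps : R, [/\ 0 < l, 0 < eps &
    forall x : 'rV[R]_n, enorm (x - xbar) <= eps ->
      (objective xbar + (l / 2 * enorm (x - xbar) ^+ 2)%:E
        <= objective x)%E].

End ConstrainedProblem.

Definition is_max {R : realType} (S : set (\bar R)) (M : \bar R) : Prop :=
  S M /\ ubound S M.

(* Main.v *)
Require Import Defs.
From HB Require Import structures.
From mathcomp Require Import all_boot all_order all_algebra.
From mathcomp Require Import all_classical all_reals all_analysis.
From mathcomp Require Import ring lra.

Set Implicit Arguments.
Unset Strict Implicit.
Unset Printing Implicit Defensive.

Import Order.TTheory GRing.Theory Num.Theory.
Import numFieldNormedType.Exports.

Local Open Scope classical_set_scope.
Local Open Scope ring_scope.

(* By metric subregularity, every vector u is within kappa |u J + H w - p| of a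
   second-order tangent of Omega at xbar for w, for each second-order tangent p
   of Theta (here J is the derivative of f and H w its second derivative along
   w). A linear functional bounded above on the second-order tangents of Omega is
   therefore bounded on all u up to an exact penalty, and a finite-dimensional
   Hahn-Banach argument turns the penalized inequality into a multiplier at
   which the dual value max_lam <lam, H w> - sigma(lam) is attained, sigma being
   the support function of the second-order tangents of Theta. Parabolic
   regularity identifies - sigma(lam) with the second subderivative of the
   indicator, so the maximum in the theorem equals the infimum of
   <phi''(xbar) w, w> - <vbar, u> over the second-order tangents u of Omega;
   Taylor expansion of phi along such tangents gives the necessary conditions.
   Sufficiency is the usual contradiction along a normalized minimizing sequence. *)

(** * Sublinear functions, the Euclidean product and sequences *)

Section Sublinear.
Context {R : realType}.

(** Homogeneity is kept as an inequality: applied to [t^-1] it gives the reverse one for [t > 0],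
    and [t = 0] gives [q 0 <= 0]. *)
Definition sublinear (V : lmodType R) (q : V -> R) : Prop :=
  (forall x y, q (x + y) <= q x + q y) /\
  (forall t x, 0 <= t -> q (t *: x) <= t * q x).

Definition cone_of_pairs (V : lmodType R) (K : V -> R -> Prop) : Prop :=
  [/\ K 0 0,
      (forall x r y s, K x r -> K y s -> K (x + y) (r + s)) &
      (forall t x r, 0 <= t -> K x r -> K (t *: x) (t * r))].

(** One Hahn-Banach step. The infimum of [q (y + x) - r] over the pairs of the convex cone [K] is
    again sublinear, and evaluating it at [- x] with the pair [(x, r)] shows that every linear
    minorant of the new function is at least [r] at [x]. *)
Lemma sublinear_inf (V : lmodType R) (q : V -> R) (K : V -> R -> Prop) :
  sublinear q -> cone_of_pairs K -> (forall x r, K x r -> r <= q x) ->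
  exists q' : V -> R, [/\ sublinear q', (forall x, q' x <= q x) &
    forall x r, K x r -> q' (- x) <= - r].
Proof.
move=> [qD qZ] [K0 KD KZ] Kq.
pose E y := [set z | exists x r, K x r /\ z = q (y + x) - r].
have E0 y : E y !=set0 by exists (q (y + 0) - 0), 0, 0.
have Elb y : has_lbound (E y).
  (* Subadditivity gives [q x <= q (y + x) + q (- y)], and [r <= q x] on [K]. *)
  exists (- q (- y)) => _ [x [r [Kxr ->]]].
  have := qD (y + x) (- y); rewrite addrAC subrr add0r => h.
  have := Kq _ _ Kxr; lra.
have Ele y x r : K x r -> inf (E y) <= q (y + x) - r.
  by move=> Kxr; apply: ge_inf => //; exists x, r.
have le_q x : inf (E x) <= q x by have := Ele x 0 0 K0; rewrite addr0 subr0.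
exists (fun y => inf (E y)); split => //; last first.
  move=> x r Kxr; apply: le_trans (Ele _ _ _ Kxr) _.
  rewrite addNr gerDr.
  by have := qZ 0 0 (lexx _); rewrite scale0r mul0r.
split=> [x y|t x].
  rewrite -lerBlDr; apply: lb_le_inf => // _ [x' [r [Kx ->]]].
  rewrite lerBlDr [leRHS]addrC -lerBlDr; apply: lb_le_inf => // _ [y' [s [Ky ->]]].
  rewrite lerBlDr; have := Ele (x + y) _ _ (KD _ _ _ _ Kx Ky).
  have := qD (x + x') (y + y'); rewrite addrACA; lra.
rewrite le_eqVlt => /predU1P[<-|t0].
  rewrite scale0r mul0r (le_trans (le_q 0))//.
  by have := qZ 0 0 (lexx _); rewrite scale0r mul0r.
rewrite mulrC -ler_pdivrMr//; apply: lb_le_inf => // _ [x' [r [Kx ->]]].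
rewrite ler_pdivrMr//; apply: le_trans (Ele _ _ _ (KZ t _ _ (ltW t0) Kx)) _.
by rewrite -scalerDr mulrBl (mulrC r) lerD2r mulrC qZ// ltW.
Qed.

End Sublinear.

Section DotTheory.
Context {R : realType} {n : nat}.
Implicit Types (u v w x : 'rV[R]_n) (a : R).

Lemma dotC u v : dot u v = dot v u.
Proof. by apply: eq_bigr => i _; rewrite mulrC. Qed.

Lemma dotDr u v w : dot u (v + w) = dot u v + dot u w.
Proof. by rewrite -big_split; apply: eq_bigr => i _; rewrite mxE mulrDr. Qed.

Lemma dotZr a u v : dot u (a *: v) = a * dot u v.
Proof. by rewrite mulr_sumr; apply: eq_bigr => i _; rewrite mxE mulrCA. Qed.

Lemma dotDl u v w : dot (v + w) u = dot v u + dot w u.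
Proof. by rewrite !(dotC _ u) dotDr. Qed.

Lemma dotZl a u v : dot (a *: v) u = a * dot v u.
Proof. by rewrite !(dotC _ u) dotZr. Qed.

Lemma dotNr u v : dot u (- v) = - dot u v.
Proof. by rewrite -scaleN1r dotZr mulN1r. Qed.

Lemma dotNl u v : dot (- v) u = - dot v u.
Proof. by rewrite !(dotC _ u) dotNr. Qed.

Lemma dotBr u v w : dot u (v - w) = dot u v - dot u w.
Proof. by rewrite dotDr dotNr. Qed.

Lemma dotBl u v w : dot (v - w) u = dot v u - dot w u.
Proof. by rewrite dotDl dotNl. Qed.

Lemma dot0r u : dot u 0 = 0.
Proof. by rewrite -(scale0r u) dotZr mul0r. Qed.

Lemma dot_delta u i : dot u (delta_mx 0 i) = u 0 i.
Proof.
rewrite /dot (bigD1 i)//= big1 ?addr0 => [|j ji]; first by rewrite mxE !eqxx mulr1.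
by rewrite mxE (negPf ji) andbF mulr0.
Qed.

Lemma dot_inj u v : (forall w, dot u w = dot v w) -> u = v.
Proof. by move=> uv; apply/rowP => i; rewrite -!dot_delta. Qed.

Lemma ler_coord (k l : nat) (A : 'M[R]_(k, l)) i j : `|A i j| <= `|A|.
Proof.
rewrite -[leRHS]/(mx_norm A) mx_normrE.
by apply: (@le_bigmax _ _ _ 0 (fun ij : 'I_k * 'I_l => `|A ij.1 ij.2|) (i, j)).
Qed.

Lemma ler_mx_norm (k l : nat) (A : 'M[R]_(k, l)) a :
  0 <= a -> (forall i j, `|A i j| <= a) -> `|A| <= a.
Proof.
move=> a0 Aa; rewrite -[leLHS]/(mx_norm A) mx_normrE.
by apply/bigmax_leP; split => // -[i j] _; exact: Aa.
Qed.

Lemma ler_norm_dot u v : `|dot u v| <= n%:R * (`|u| * `|v|).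
Proof.
apply: le_trans (ler_norm_sum _ _ _) _.
apply: (@le_trans _ _ (\sum_(i < n) (`|u| * `|v|))).
  by apply: ler_sum => i _; rewrite normrM ler_pM// ler_coord.
by rewrite sumr_const card_ord mulr_natl.
Qed.

Lemma ler_dot u v : dot u v <= n%:R * (`|u| * `|v|).
Proof. exact: le_trans (ler_norm _) (ler_norm_dot _ _). Qed.

Lemma dot_ge0 u : 0 <= dot u u.
Proof. by apply: sumr_ge0 => i _; rewrite -expr2 sqr_ge0. Qed.

Lemma enorm_ge0 u : 0 <= enorm u.
Proof. exact: sqrtr_ge0. Qed.

Lemma sqr_enorm u : enorm u ^+ 2 = dot u u.
Proof. by rewrite sqr_sqrtr// dot_ge0. Qed.

Lemma norm_le_enorm u : `|u| <= enorm u.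
Proof.
apply: ler_mx_norm => [|i j]; first exact: enorm_ge0.
rewrite ord1 -sqrtr_sqr; apply: ler_wsqrtr.
rewrite /dot (bigD1 j)//= expr2 lerDl.
by apply: sumr_ge0 => k _; rewrite -expr2 sqr_ge0.
Qed.

(** The constant is crude but positive also for [n = 0], so that radii can be divided by it. *)
Lemma enorm_le_norm u : enorm u <= n.+1%:R * `|u|.
Proof.
rewrite -(@ler_pXn2r _ 2)// ?nnegrE ?enorm_ge0 ?mulr_ge0//.
rewrite sqr_enorm exprMn; apply: le_trans (ler_dot _ _) _.
rewrite -expr2 ler_wpM2r// ?sqr_ge0// -natrX ler_nat.
by rewrite (leq_trans (leqnSn n))// -mulnn leq_pmulr.
Qed.

Lemma enormZ a u : enorm (a *: u) = `|a| * enorm u.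
Proof.
by rewrite /enorm dotZr dotZl mulrA -expr2 sqrtrM ?sqr_ge0// sqrtr_sqr.
Qed.

Lemma enorm_gt0 u : u != 0 -> 0 < enorm u.
Proof. by move=> u0; apply: lt_le_trans (norm_le_enorm u); rewrite normr_gt0. Qed.

Lemma norm_le_dot u a : 0 <= a -> (forall v, dot u v <= a * `|v|) -> `|u| <= a.
Proof.
move=> a0 ua; apply: ler_mx_norm => // i j; rewrite ord1 ler_norml.
have d1 : `|delta_mx 0 j : 'rV[R]_n| <= 1.
  by apply: ler_mx_norm => // k l; rewrite mxE normr_nat lern1 leq_b1.
apply/andP; split; last first.
  by rewrite -(dot_delta u j) (le_trans (ua (delta_mx 0 j)))// ler_piMr.
by rewrite lerNl -(dot_delta u j) -dotNr (le_trans (ua (- delta_mx 0 j)))// normrN ler_piMr.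
Qed.

Lemma mx_cvgP (k l : nat) (F : set_system nat) {FF : Filter F}
    (A_ : nat -> 'M[R]_(k, l)) (A : 'M[R]_(k, l)) :
  (forall i j, (fun p => A_ p i j) @ F --> A i j) -> A_ @ F --> A.
Proof.
move=> cA; apply/cvgrPdist_le => e e0.
have : \forall p \near F, forall ij : 'I_k * 'I_l, `|A ij.1 ij.2 - A_ p ij.1 ij.2| <= e.
  apply: filter_forall => -[i j] /=.
  by have /cvgrPdist_le/(_ e e0) := cA i j.
apply: filterS => p h; apply: ler_mx_norm; first exact: ltW.
by move=> i j; rewrite !mxE; exact: (h (i, j)).
Qed.

Lemma mx_cvg_coord (k l : nat) (T : Type) (F : set_system T) {FF : Filter F}
    (A_ : T -> 'M[R]_(k, l)) (A : 'M[R]_(k, l)) i j :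
  A_ @ F --> A -> (fun p => A_ p i j) @ F --> A i j.
Proof.
move=> /cvgrPdist_le cA; apply/cvgrPdist_le => e e0.
apply: filterS (cA e e0) => p; apply: le_trans.
by have := ler_coord (A - A_ p) i j; rewrite !mxE.
Qed.

Lemma cvg_dot (T : Type) (F : set_system T) {FF : Filter F}
    (u_ v_ : T -> 'rV[R]_n) u v :
  u_ @ F --> u -> v_ @ F --> v -> (fun k => dot (u_ k) (v_ k)) @ F --> dot u v.
Proof.
move=> cu cv; apply: cvg_big; first exact: add_continuous.
by move=> i _; apply: cvgM; apply: mx_cvg_coord.
Qed.

End DotTheory.

Lemma dot_mulmx {R : realType} (n m : nat) (w : 'rV[R]_n) (A : 'M[R]_(n, m)) lam :
  dot (w *m A) lam = dot w (lam *m A^T).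
Proof.
have dE k (a b : 'rV[R]_k) : dot a b = (a *m b^T) 0 0.
  by rewrite mxE; apply: eq_bigr => i _; rewrite mxE.
by rewrite !dE trmx_mul trmxK mulmxA.
Qed.

Section Sequences.
Context {R : realType}.

(** Extractions are only required to satisfy [k <= s k]; monotonicity is never asked for, so indices
    can be chosen independently of each other. *)
Lemma cvg_ge_nat (s : nat -> nat) : (forall k, k <= s k)%N -> s @ \oo --> \oo.
Proof.
move=> sk A [N _ NA]; exists N => // k /= Nk; apply: NA => /=.
exact: leq_trans Nk (sk k).
Qed.

Lemma cvg_subseq (T : topologicalType) (u : nat -> T) (s : nat -> nat) (p : T) :
  (forall k, k <= s k)%N -> u @ \oo --> p -> (fun k => u (s k)) @ \oo --> p.
Proof. by move=> sk up; apply: cvg_comp up; exact: cvg_ge_nat. Qed.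

(** Closed balls of the sup norm are compact, so the sequence has a cluster point [p]; the index
    [s k >= k] is chosen with [u (s k)] within [1/(k+1)] of [p]. *)
Lemma bounded_subseq n (u : nat -> 'rV[R]_n) (M : R) :
  (forall k, `|u k| <= M) ->
  exists (s : nat -> nat) (p : 'rV[R]_n),
    (forall k, k <= s k)%N /\ (fun k => u (s k)) @ \oo --> p.
Proof.
move=> uM.
have cK : compact [set x : 'rV[R]_n | `|x| <= M].
  apply: bounded_closed_compact.
    by exists M; split; [exact: num_real|move=> N MN x /= xM; exact: le_trans xM (ltW MN)].
  have -> : [set x : 'rV[R]_n | `|x| <= M] = (fun x => `|x|) @^-1` [set r | r <= M] by [].
  apply: closed_comp; last exact: closed_le.
  by move=> x _; exact: norm_continuous.
have uK : (u @ \oo) [set x : 'rV[R]_n | `|x| <= M] by exists 0%N => // k _ /=; exact: uM.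
have [p [_ clp]] := cK (u @ \oo) _ uK.
have ex k : exists j, (k <= j)%N /\ `|p - u j| < k.+1%:R^-1.
  have uk : (u @ \oo) (u @` [set j | (k <= j)%N]) by exists k => // j /= kj; exists j.
  have pk : nbhs p (ball p (k.+1%:R^-1 : R)) by apply: nbhsx_ballx; rewrite invr_gt0.
  have [_ [[j kj <-] bj]] := clp _ _ uk pk.
  by exists j; split => //; move: bj; rewrite -ball_normE.
have [s sP] := choice ex.
exists s, p; split=> [k|]; first by case: (sP k).
apply/cvgrPdist_lt => e e0.
have := near_infty_natSinv_lt (PosNum e0); apply: filterS => k /= ke.
by apply: lt_trans ke; case: (sP k).
Qed.

End Sequences.

(** * Finite-dimensional duality *)

Section Duality.
Context {R : realType}.

(** Hahn-Banach by induction on basis vectors: [q] is lowered until it is linear along each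
    coordinate axis. Subadditivity then puts the result below the linear form with these
    coordinates, and applying this to [- y] puts it above. *)
Lemma sublinear_minorant (m : nat) (q : 'rV[R]_m -> R) :
  sublinear q -> exists lam : 'rV[R]_m, forall y, dot lam y <= q y.
Proof.
move=> sq.
have H : forall s : seq 'I_m, exists (q' : 'rV[R]_m -> R) (a : 'I_m -> R),
    [/\ sublinear q', (forall y, q' y <= q y) & forall i, i \in s ->
       q' (delta_mx 0 i) <= a i /\ q' (- delta_mx 0 i) <= - a i].
  elim=> [|i s [q1 [a [sq1 q1q q1a]]]]; first by exists q, (fun=> 0).
  (* The ray through [(e_i, q1 e_i)] forces [q2 (- e_i) <= - q1 e_i]; axes already treated keep
     their bounds because [q2 <= q1]. *)
  pose K (y : 'rV[R]_m) r := exists2 t, 0 <= t &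
    y = t *: delta_mx 0 i /\ r = t * q1 (delta_mx 0 i).
  have [||q2 [sq2 q2q1 q2K]] := @sublinear_inf _ _ q1 K sq1.
  - split.
    + by exists 0; rewrite // scale0r mul0r.
    + move=> x r y u [t t0 [-> ->]] [t' t'0 [-> ->]]; exists (t + t').
        exact: addr_ge0.
      by rewrite scalerDl mulrDl.
    + move=> t x r t0 [t' t'0 [-> ->]]; exists (t * t'); first exact: mulr_ge0.
      by rewrite scalerA mulrA.
  - move=> y r [t t0 [-> ->]]; move: t0; rewrite le_eqVlt => /predU1P[<-|t0].
      rewrite scale0r mul0r -(subrr 0).
      have := sq1.1 0 0; rewrite addr0 subr0; lra.
    rewrite mulrC -ler_pdivlMr// mulrC.
    have /= := sq1.2 t^-1 (t *: delta_mx 0 i); rewrite scalerA mulVf ?gt_eqF//.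
    by rewrite scale1r invr_ge0 ltW//; exact.
  exists q2, (fun j => if j == i then q1 (delta_mx 0 i) else a j); split=> //.
    by move=> y; exact: le_trans (q2q1 y) (q1q y).
  move=> j; rewrite inE; case: eqVneq => [-> _|ji /= js].
    split; first exact: q2q1.
    by apply: q2K; exists 1; rewrite // scale1r mul1r.
  have [h1 h2] := q1a j js.
  by split; [exact: le_trans h1|exact: le_trans h2].
have [q' [a [sq' q'q q'a]]] := H (enum 'I_m).
pose lam : 'rV[R]_m := \row_i a i.
have q'Z i r : q' (r *: delta_mx 0 i) <= a i * r.
  have [h1 h2] := q'a i (mem_enum _ i).
  have [r0|r0] := leP 0 r.
    apply: le_trans (sq'.2 _ _ r0) _.
    by rewrite mulrC ler_wpM2r.
  have -> : r *: delta_mx 0 i = (- r) *: (- delta_mx 0 i) :> 'rV[R]_m.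
    by rewrite scalerN scaleNr opprK.
  apply: le_trans (sq'.2 _ _ _) _; first by rewrite oppr_ge0 ltW.
  have : 0 <= - r by rewrite oppr_ge0 ltW.
  by move=> /ler_wpM2l/(_ _ _ h2)/le_trans; apply; lra.
have q'0 : q' 0 <= 0 by have := sq'.2 0 0 (lexx _); rewrite scale0r mul0r.
have q'lam y : q' y <= dot lam y.
  rewrite {1}(row_sum_delta y) /dot.
  elim/big_ind2 : _ => //.
    move=> x1 r1 x2 r2 h1 h2; apply: le_trans (sq'.1 _ _) _; exact: lerD.
  by move=> i _; rewrite mxE; exact: q'Z.
exists lam => y; apply: le_trans (q'q y).
have := q'lam (- y); rewrite dotNr.
have := sq'.1 y (- y); rewrite subrr.
have := sq'.2 (-1 + 1) y; rewrite addNr => /(_ (lexx _)).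
have q00 : 0 <= q' 0 by have := sq'.1 0 0; rewrite addr0; lra.
lra.
Qed.

(** Convexity with a plain real weight instead of the interval-typed weight of [convex_set]. *)
Definition closed_under_segments (V : lmodType R) (S : set V) : Prop :=
  forall x y t, 0 <= t <= 1 -> S x -> S y -> S (t *: x + (1 - t) *: y).

Lemma convex_set_segments (V : lmodType R) (S : set V) :
  @convex_set R V S -> closed_under_segments S.
Proof.
move=> cS x y t /andP[t0 t1] Sx Sy.
have := cS x y (Itv01 t0 t1); rewrite !inE; exact.
Qed.

(** The pairs [(b + u A - p, <v, u> - a)] generate a cone, convex because [S] is, and lying below
    the sublinear function [c |y|]. A linear form [lam] separating the two satisfies
    [<v, u> - a <= <lam, b + u A - p>] for all [u] and [p]. Letting [u] range over a line forces
    [lam A^T = v], and [u = 0] bounds [lam] on [S]. *)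
Lemma dual_multiplier (n m : nat) (S : set 'rV[R]_m) (A : 'M[R]_(n, m))
    (b : 'rV[R]_m) (v : 'rV[R]_n) (a c : R) :
  0 <= c -> closed_under_segments S -> S !=set0 ->
  (forall u p, S p -> dot v u - a <= c * `|b + u *m A - p|) ->
  exists lam : 'rV[R]_m, [/\ lam *m A^T = v,
    (forall p, S p -> dot lam p <= dot lam b + a) &
    (forall y, dot lam y <= c * `|y|)].
Proof.
move=> c0 cS [p0 Sp0] vS.
pose q (y : 'rV[R]_m) := c * `|y|.
have sq : sublinear q.
  split=> [x y|t x t0]; first by rewrite /q -mulrDr ler_wpM2l// ler_normD.
  by rewrite /q normrZ ger0_norm// mulrCA.
pose K (y : 'rV[R]_m) r := exists t u p, [/\ 0 <= t, S p,
    y = t *: (b + u *m A - p) & r = t * (dot v u - a)].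
have [||q' [sq' q'q q'K]] := @sublinear_inf _ _ q K sq.
- split.
  + by exists 0, 0, p0; split; rewrite // ?scale0r ?mul0r.
  + move=> _ _ _ _ [t1 [u1 [p1 [t10 Sp1 -> ->]]]] [t2 [u2 [p2 [t20 Sp2 -> ->]]]].
    have : 0 <= t1 + t2 by exact: addr_ge0.
    rewrite le_eqVlt => /predU1P[/esym/eqP|t12].
      rewrite paddr_eq0// => /andP[/eqP-> /eqP->].
      by exists 0, 0, p0; split; rewrite // ?scale0r ?mul0r ?addr0.
    have t12N : t1 + t2 != 0 by rewrite gt_eqF.
    (* The sum of two generators is the generator at the convex combination with weight [s], scaled
       by [t1 + t2]. *)
    pose s := t1 / (t1 + t2).
    have s1 : 1 - s = t2 / (t1 + t2) by rewrite /s; field.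
    have ts1 : (t1 + t2) * s = t1 by rewrite /s; field.
    have ts2 : (t1 + t2) * (1 - s) = t2 by rewrite s1; field.
    exists (t1 + t2), (s *: u1 + (1 - s) *: u2), (s *: p1 + (1 - s) *: p2); split.
    * exact: ltW.
    * apply: cS => //; rewrite /s; apply/andP; split; first by rewrite divr_ge0// ltW.
      by rewrite ler_pdivrMr// mul1r lerDl.
    * have -> : b + (s *: u1 + (1 - s) *: u2) *m A - (s *: p1 + (1 - s) *: p2) =
          s *: (b + u1 *m A - p1) + (1 - s) *: (b + u2 *m A - p2).
        rewrite mulmxDl -!scalemxAl.
        by apply/rowP => j; rewrite !mxE; ring.
      by rewrite [RHS]scalerDr !scalerA ts1 ts2.
    * rewrite dotDr !dotZr -[X in X * _ + _]ts1 -[X in _ + X * _]ts2; ring.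
  + move=> t _ _ t0 [t' [u [p [t'0 Sp -> ->]]]].
    by exists (t * t'), u, p; split; rewrite ?mulr_ge0// ?scalerA ?mulrA.
- move=> _ _ [t [u [p [t0 Sp -> ->]]]].
  by rewrite /q normrZ ger0_norm// mulrCA ler_wpM2l// vS.
have [lam lamq'] := sublinear_minorant sq'.
have lamle y : dot lam y <= c * `|y| by exact: le_trans (lamq' y) (q'q y).
have key u p : S p -> dot v u - a <= dot lam (b + u *m A - p).
  move=> Sp; rewrite -lerN2 -dotNr; apply: le_trans (lamq' _) (q'K _ _ _).
  by exists 1, u, p; rewrite scale1r mul1r.
have lamv : lam *m A^T = v.
  apply: dot_inj => u; rewrite dotC -dot_mulmx dotC; apply/eqP; rewrite eq_sym -subr_eq0.
  set x := _ - _; apply/negPn/negP => x0.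
  have H s : s * x <= a + dot lam (b - p0).
    have := key (s *: u) p0 Sp0.
    rewrite -scalemxAl addrAC (dotDr lam (b - p0)) !dotZr /x; lra.
  (* This multiple of [u] makes the left side exceed the bound by exactly 1. *)
  have := H ((a + dot lam (b - p0) + 1) / x); rewrite divfK//; lra.
exists lam; split=> // p Sp.
by have := key 0 p Sp; rewrite mul0mx addr0 dot0r dotBr; lra.
Qed.

End Duality.

(** * Second-order expansions *)

Section Expansions.
Context {R : realType}.

Lemma diff_bound (V W : normedModType R) (f : V -> W) (x : V) (e : R) :
  differentiable f x -> 0 < e ->
  \forall h \near (0 : V), `|f (x + h) - f x - 'd f x h| <= e * `|h|.
Proof.
move=> df e0; have /eqaddoP/(_ _ e0) := diff_locally df.
apply: filterS => h /=; rewrite !fctE /= opprD addrA [h + x]addrC.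
by [].
Qed.

(** The gradient [G] is differentiable at [x] only, so no second derivative at nearby points is
    available. The mean value theorem is applied instead to the remainder along the segment, whose
    derivative is the first-order error of [G] paired with [h]. *)
Lemma taylor2_bound n (g : 'rV[R]_n -> R) (G : 'rV[R]_n -> 'rV[R]_n) x (e : R) :
  (\forall y \near x, differentiable g y /\ forall h, 'd g y h = dot (G y) h) ->
  differentiable G x -> 0 < e ->
  \forall h \near (0 : 'rV[R]_n),
    `|g (x + h) - g x - dot (G x) h - 2^-1 * dot ('d G x h) h| <= e * `|h| ^+ 2.
Proof.
move=> dg dG e0.
(* Division by [n.+1] absorbs the factor [n] of [ler_norm_dot]. *)
have e'0 : 0 < e / n.+1%:R by rewrite divr_gt0.
have /nbhs_ballP[d1 /= d10 H1] := dg.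
have /nbhs_ballP[d2 /= d20 H2] := diff_bound dG e'0.
have d0 : 0 < Num.min d1 d2 by rewrite lt_min d10.
apply/nbhs_ballP; exists (Num.min d1 d2) => //= h.
rewrite -ball_normE /= sub0r normrN lt_min => /andP[hd1 hd2].
pose F (s : R) := g (x + s *: h) - s * dot (G x) h - s ^+ 2 * (2^-1 * dot ('d G x h) h).
pose dF (s : R) := dot (G (x + s *: h)) h - dot (G x) h - s * dot ('d G x h) h.
have near_seg (s : R) : 0 <= s <= 1 -> `|s *: h| <= `|h|.
  by move=> /andP[s0 s1]; rewrite normrZ ger0_norm// ler_piMl.
have Fd (s : R) : 0 <= s <= 1 -> is_derive s (1 : R) F (dF s).
  move=> s01.
  have [dgs dgsE] : differentiable g (x + s *: h) /\
      forall h', 'd g (x + s *: h) h' = dot (G (x + s *: h)) h'.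
    apply: H1; rewrite -ball_normE /= opprD addNKr normrN.
    exact: le_lt_trans (near_seg _ s01) hd1.
  have d1' : is_diff s (fun s : R => x + s *: h) (fun s : R => 0 + s *: h).
    exact: is_diffD.
  have d2' : is_diff s (g \o (fun s : R => x + s *: h))
      ('d g (x + s *: h) \o (fun s : R => 0 + s *: h)).
    by apply: is_diff_comp; exact: differentiableP.
  have d3 : is_derive s (1 : R) (g \o (fun s : R => x + s *: h)) (dot (G (x + s *: h)) h).
    apply: DeriveDef; first exact/diff_derivable/ex_diff.
    by rewrite deriveE ?diff_val /= ?add0r ?scale1r ?dgsE//; exact: ex_diff.
  rewrite /F /dF; apply: is_derive_eq.
  by rewrite /GRing.scale/=; field.
have [c c01 FE] : exists2 c, c \in `[0, 1]%R & F 1 - F 0 = dF c * (1 - 0).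
  apply: MVT_segment => //.
    by move=> s; rewrite in_itv /= => /andP[s0 s1]; apply: Fd; rewrite !ltW.
  apply: derivable_within_continuous => s; rewrite in_itv/= => s01.
  by have [] := Fd s s01.
move: c01; rewrite in_itv /= => c01.
have -> : g (x + h) - g x - dot (G x) h - 2^-1 * dot ('d G x h) h = dF c.
  move: FE; rewrite subr0 mulr1 => <-; rewrite /F !scale1r scale0r addr0; ring.
have -> : dF c = dot (G (x + c *: h) - G x - 'd G x (c *: h)) h.
  by rewrite !dotBl linearZ dotZl.
apply: le_trans (ler_norm_dot _ _) _.
have b1 : `|G (x + c *: h) - G x - 'd G x (c *: h)| <= e / n.+1%:R * `|h|.
  apply: le_trans (H2 _ _) _.
    by rewrite -ball_normE /= sub0r normrN; exact: le_lt_trans (near_seg _ c01) hd2.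
  by apply: ler_wpM2l; [exact: ltW|exact: near_seg].
apply: (@le_trans _ _ (n%:R * (e / n.+1%:R * `|h| * `|h|))).
  by rewrite ler_wpM2l// ler_wpM2r.
have -> : n%:R * (e / n.+1%:R * `|h| * `|h|) = n%:R / n.+1%:R * (e * `|h| ^+ 2).
  ring.
apply: ler_piMl; first by rewrite mulr_ge0 ?sqr_ge0// ltW.
by rewrite ler_pdivrMr// mul1r ler_nat.
Qed.

Lemma cvg_bounded_norm (V : normedModType R) (u : nat -> V) (l : V) :
  u @ \oo --> l -> \forall k \near \oo, `|u k| <= `|l| + 1.
Proof.
move=> /cvgrPdist_le/(_ 1 ltr01); apply: filterS => k h.
rewrite -lerBlDl; apply: le_trans h; rewrite distrC; exact: lerB_dist.
Qed.

Lemma cvg_scale0 (V : normedModType R) (t : nat -> R) (u : nat -> V) (l : V) :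
  t @ \oo --> (0 : R) -> u @ \oo --> l -> (fun k => t k *: u k) @ \oo --> (0 : V).
Proof. by move=> ct cu; rewrite -(scale0r l); exact: cvgZ. Qed.

Lemma taylor2_seq n (g : 'rV[R]_n -> R) (G : 'rV[R]_n -> 'rV[R]_n) x
    (t : nat -> R) (w_ : nat -> 'rV[R]_n) w :
  (\forall y \near x, differentiable g y /\ forall h, 'd g y h = dot (G y) h) ->
  differentiable G x ->
  (forall k, 0 < t k) -> t @ \oo --> (0 : R) -> w_ @ \oo --> w ->
  (fun k => (2^-1 * t k ^+ 2)^-1 *
    (g (x + t k *: w_ k) - g x - t k * dot (G x) (w_ k))) @ \oo -->
  dot ('d G x w) w.
Proof.
move=> dg dG t0 ct cw.
have cD : (fun k => dot ('d G x (w_ k)) (w_ k)) @ \oo --> dot ('d G x w) w.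
  apply: cvg_dot => //; apply: (continuous_cvg _ _ cw).
  exact: diff_continuous.
rewrite -[X in _ --> X]add0r.
set Q := fun k => _; set D := fun k => dot _ _ in cD.
have -> : Q = (Q \- D) \+ D by apply/funext => k /=; rewrite subrK.
apply: cvgD cD; apply/cvgr0Pnorm_le => e e0.
pose M := `|w| + 1.
have M0 : 0 < M by rewrite ltr_wpDl.
(* The 2 cancels the half in the scale [t^2 / 2], and [M] bounds the directions [w_ k]. *)
have e'0 : 0 < e / (2 * M ^+ 2) by rewrite divr_gt0// mulr_gt0// exprn_gt0.
have H := taylor2_bound dg dG e'0.
have {}H := cvg_scale0 ct cw H.
near=> k.
have wM : `|w_ k| <= M by near: k; exact: cvg_bounded_norm.
have : `|g (x + t k *: w_ k) - g x - dot (G x) (t k *: w_ k) -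
    2^-1 * dot ('d G x (t k *: w_ k)) (t k *: w_ k)| <=
    e / (2 * M ^+ 2) * `|t k *: w_ k| ^+ 2 by near: k.
rewrite ['d G x (t k *: _)]linearZ /= dotZl !dotZr normrZ (gtr0_norm (t0 k)) => h.
have tk := t0 k; have tk0 : t k != 0 by rewrite gt_eqF.
have -> : Q k - D k = (2^-1 * t k ^+ 2)^-1 *
    (g (x + t k *: w_ k) - g x - t k * dot (G x) (w_ k) -
     2^-1 * (t k * (t k * dot ('d G x (w_ k)) (w_ k)))).
  by rewrite /Q /D /=; field.
have s0 : 0 < 2^-1 * t k ^+ 2 by rewrite mulr_gt0 ?exprn_gt0.
rewrite normrM normfV (gtr0_norm s0) mulrC ler_pdivrMr//.
apply: le_trans h _.
rewrite exprMn.
have : `|w_ k| ^+ 2 <= M ^+ 2 by rewrite ler_sqr ?nnegrE// ltW.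
move=> wM2.
have -> : e / (2 * M ^+ 2) * (t k ^+ 2 * `|w_ k| ^+ 2) =
   (e * t k ^+ 2 / 2) * (`|w_ k| ^+ 2 / M ^+ 2).
  by field; rewrite gt_eqF.
have -> : e * (2^-1 * t k ^+ 2) = e * t k ^+ 2 / 2 by ring.
apply: ler_piMr; last by rewrite ler_pdivrMr ?exprn_gt0// mul1r.
by rewrite divr_ge0 ?mulr_ge0 ?sqr_ge0// ltW.
Unshelve. all: by end_near. Qed.

End Expansions.

(** * Normal cones, second subderivatives and second-order tangents *)

Lemma limf_esup_lt (T : choiceType) (X : filteredType T) (R : realType)
    (f : X -> \bar R) (F : set_system X) (a : \bar R) :
  (limf_esup f F < a)%E -> exists2 V, F V & forall y, V y -> (f y < a)%E.
Proof.
rewrite limf_esupE => /ereal_inf_lt[_ [V FV <-] Va]; exists V => // y Vy.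
by apply: le_lt_trans Va; apply: ereal_sup_ubound; exists y.
Qed.

Lemma cvg_right0 (R : realType) (t : nat -> R) :
  (forall k, 0 < t k) -> t @ \oo --> (0 : R) -> t @ \oo --> 0^'+.
Proof.
move=> t0 ct A; rewrite /at_right /within /= => /ct; rewrite /nbhs/=.
by apply: filterS => k; apply; exact: t0.
Qed.

Section NormalCones.
Context {R : realType} {n : nat}.
Implicit Types (A : set 'rV[R]_n) (x y v w : 'rV[R]_n).

Lemma regular_normal_near A x v (e : R) : regular_normal_cone A x v -> 0 < e ->
  \forall y \near x, A y -> dot v (y - x) <= e * enorm (y - x).
Proof.
move=> vN e0.
have [|V FV Vlt] := @limf_esup_lt _ _ _ _ _ e%:E (le_lt_trans vN _).
  by rewrite lte_fin.
have {}FV : \forall y \near x, y != x -> A y -> V y by exact: FV.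
apply: filterS FV => y; have [->|yx] := eqVneq y x.
  by rewrite subrr dot0r mulr_ge0 ?enorm_ge0// ltW.
move=> Vy Ay; have := Vlt y (Vy isT Ay); rewrite lte_fin ltr_pdivrMr.
  exact: ltW.
by apply: enorm_gt0; rewrite subr_eq0.
Qed.

Lemma regular_normal_tangent A x v w :
  regular_normal_cone A x v -> tangent_cone A x w -> dot v w <= 0.
Proof.
move=> vN [t [w_ [t0 ct cw Aw]]].
have ctw := cvg_scale0 ct cw.
have cx : (fun k => x + t k *: w_ k) @ \oo --> x.
  by rewrite -[X in _ --> X]addr0; apply: cvgD ctw; exact: cvg_cst.
have M0 : 0 <= n.+1%:R * (`|w| + 1) :> R by rewrite mulr_ge0// addr_ge0.
suff H e : 0 < e -> dot v w <= e * (n.+1%:R * (`|w| + 1)).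
  rewrite leNgt; apply/negP => vw0.
  have P : 0 < n.+1%:R * (`|w| + 1) + 1 :> R by lra.
  have e0 : 0 < dot v w / (n.+1%:R * (`|w| + 1) + 1) by rewrite divr_gt0.
  have := H _ e0; rewrite mulrAC ler_pdivlMr//; nra.
move=> e0.
apply: (cvgr_to_le (cvg_dot (cvg_cst v) cw)).
have Nw := cx _ (regular_normal_near vN e0).
near=> k.
have : A (x + t k *: w_ k) -> dot v (x + t k *: w_ k - x) <=
    e * enorm (x + t k *: w_ k - x) by near: k.
rewrite addrAC subrr add0r dotZr enormZ (gtr0_norm (t0 k)) mulrCA ler_pM2l//.
move=> /(_ (Aw k))/le_trans; apply.
rewrite ler_pM2l//; apply: le_trans (enorm_le_norm _) _.
rewrite ler_wpM2l//.
by near: k; exact: cvg_bounded_norm.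
Unshelve. all: by end_near. Qed.

(** From left to right, [y - x_ k] is tangent at [x_ k] by convexity, and the polarity inequality
    passes to the limit. Conversely the difference quotient is nonpositive on all of [A], so
    constant sequences serve. *)
Lemma convex_normal_coneP A x v : closed_under_segments A -> A x ->
  normal_cone A x v <-> forall y, A y -> dot v (y - x) <= 0.
Proof.
move=> cA Ax; split=> [[x_ [v_ [cx Ax_ cv vN]]] y Ay|vA].
  have cyx : (fun k => y - x_ k) @ \oo --> y - x.
    by apply: cvgB => //; exact: cvg_cst.
  apply: (cvgr_to_le (cvg_dot cv cyx)).
  apply: nearW => k; apply: (regular_normal_tangent (vN k)).
  exists (fun j => j.+1%:R^-1), (fun=> y - x_ k); split=> //.
  - exact: cvg_harmonic.
  - exact: cvg_cst.
  move=> j.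
  have -> : x_ k + j.+1%:R^-1 *: (y - x_ k) = j.+1%:R^-1 *: y + (1 - j.+1%:R^-1) *: x_ k.
    by rewrite scalerBr scalerBl scale1r addrCA.
  apply: cA => //; apply/andP; split; first by rewrite invr_ge0.
  by rewrite invf_le1// ler1n.
exists (fun=> x), (fun=> v); split=> //; [exact: cvg_cst|exact: cvg_cst|].
move=> _; rewrite /regular_normal_cone /= limf_esupE; apply: ge_ereal_inf.
exists (ereal_sup ((fun y => (dot v (y - x) / enorm (y - x))%:E) @` A)).
  by exists A => //; rewrite /within /=; apply: nearW.
apply: ge_ereal_sup => _ [y Ay <-]; rewrite lee_fin.
by rewrite mulr_le0_ge0 ?invr_ge0 ?enorm_ge0 ?vA.
Qed.

End NormalCones.

Section SecondSubderivative.
Context {R : realType} {n : nat}.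
Implicit Types (A : set 'rV[R]_n) (x y v w p : 'rV[R]_n).

(** A liminf is at most the limit along any one sequence; real majorants [b_] of the quotients keep
    the extended reals out of the limit. *)
Lemma second_subderivative_le (phi : 'rV[R]_n -> \bar R) x v w
    (t : nat -> R) (w_ : nat -> 'rV[R]_n) (b_ : nat -> R) (b : R) :
  (forall k, 0 < t k) -> t @ \oo --> (0 : R) -> w_ @ \oo --> w ->
  (\forall k \near \oo, (diff_quotient2 phi x v (t k) (w_ k) <= (b_ k)%:E)%E) ->
  b_ @ \oo --> b ->
  (second_subderivative phi x v w <= b%:E)%E.
Proof.
move=> t0 ct cw dq cb; rewrite /second_subderivative limf_einfE.
apply: ge_ereal_sup => _ [V FV <-].
have FVk : \forall k \near \oo, V (t k, w_ k).
  case: FV => -[P Q] [/= P0 Qw] PQ.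
  have Pt : \forall k \near \oo, P (t k) := cvg_right0 t0 ct P0.
  have Qt : \forall k \near \oo, Q (w_ k) := cw _ Qw.
  by near=> k; apply: PQ; split; near: k.
apply/lee_addgt0Pr => e e0.
near \oo => k.
apply: (@le_trans _ _ (diff_quotient2 phi x v (t k) (w_ k))).
  by apply: ereal_inf_lbound; exists (t k, w_ k) => //; near: k.
apply: (@le_trans _ _ (b_ k)%:E); first by near: k.
rewrite -EFinD lee_fin -lerBlDl; apply: le_trans (ler_norm _) _.
by near: k; exact: cvgr_distC_le.
Unshelve. all: by end_near. Qed.

Lemma diff_quotient2_indicator A x v t w : A x -> A (x + t *: w) ->
  diff_quotient2 (indicator A) x v t w = (- (t * dot v w) / (2^-1 * t ^+ 2))%:E.
Proof.
by move=> Ax Aw; rewrite /diff_quotient2 /indicator !mem_set// sube0 sub0e -EFinM.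
Qed.

Lemma diff_quotient2_indicator_out A x v t w : A x -> 0 < t ->
  (diff_quotient2 (indicator A) x v t w < +oo)%E -> A (x + t *: w).
Proof.
move=> Ax t0; rewrite /diff_quotient2 /indicator (mem_set Ax).
case: ifPn => [/set_mem//|_].
by rewrite sube0 -EFinN addye// gt0_mulye// lte_fin invr_gt0 mulr_gt0 ?exprn_gt0.
Qed.

Lemma second_order_tangent_near A x w p (t : nat -> R) (u_ : nat -> 'rV[R]_n) :
  (forall k, 0 < t k) -> t @ \oo --> (0 : R) -> u_ @ \oo --> p ->
  (\forall k \near \oo, A (x + t k *: w + (2^-1 * t k ^+ 2) *: u_ k)) ->
  second_order_tangent_set A x w p.
Proof.
move=> t0 ct cu [N _ NA].
exists (fun k => t (k + N)%N), (fun k => u_ (k + N)%N); split=> //.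
- by rewrite cvg_shiftn.
- by apply: cvg_subseq cu => k; exact: leq_addr.
- by move=> k; apply: NA => /=; exact: leq_addl.
Qed.

(** A parabolic arc is a step of length [t] in the moving direction [w + t/2 u], so expansions along
    converging directions apply to it. *)
Lemma parabolic_pointE x w u t :
  x + t *: w + (2^-1 * t ^+ 2) *: u = x + t *: (w + (2^-1 * t) *: u).
Proof. by rewrite scalerDr scalerA addrA; congr (_ + _ *: _); ring. Qed.

Lemma cvg_parabolic w (u : 'rV[R]_n) (t : nat -> R) (u_ : nat -> 'rV[R]_n) :
  t @ \oo --> (0 : R) -> u_ @ \oo --> u ->
  (fun k => w + (2^-1 * t k) *: u_ k) @ \oo --> w.
Proof.
move=> ct cu; rewrite -[X in _ --> X]addr0; apply: cvgD; first exact: cvg_cst.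
apply: cvg_scale0 cu; rewrite -(mulr0 2^-1); apply: cvgM => //; exact: cvg_cst.
Qed.

Lemma second_subderivative_le_tangent A x v w p : A x -> dot v w = 0 ->
  second_order_tangent_set A x w p ->
  (second_subderivative (indicator A) x v w <= (- dot v p)%:E)%E.
Proof.
move=> Ax vw [t [u_ [t0 ct cu Au]]].
apply: (@second_subderivative_le _ _ _ _ t (fun k => w + (2^-1 * t k) *: u_ k)
  (fun k => - dot v (u_ k))) => //.
- exact: cvg_parabolic cu.
- apply: nearW => k; rewrite diff_quotient2_indicator -?parabolic_pointE//.
  rewrite lee_fin dotDr vw add0r dotZr le_eqVlt; apply/orP; left; apply/eqP.
  by field; rewrite gt_eqF.
- by apply: cvgN; apply: cvg_dot cu; exact: cvg_cst.
Qed.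

(** Parabolic regularity bounds [2 (w_ k - w) / t k]; a subsequence converges to a second-order
    tangent [p]. Along it the difference quotient is minus the product of [v] with this sequence, so
    the second subderivative is attained at [p]. *)
Lemma second_subderivative_regular A x v w : A x -> dot v w = 0 ->
  parabolically_regular A x v ->
  (second_subderivative (indicator A) x v w < +oo)%E ->
  exists2 p, second_order_tangent_set A x w p &
    second_subderivative (indicator A) x v w = (- dot v p)%:E.
Proof.
move=> Ax vw reg dlt; have [t [w_ [t0 ct cw cq we]]] := reg w dlt.
set d := second_subderivative _ _ _ _ in dlt cq *.
have [M supM] : exists M : R, (limn_esup (fun k => (enorm (w_ k - w) / t k)%:E) < M%:E)%E.
  move: we; case: (limn_esup _) => [r _||_]//.
    by exists (r + 1); rewrite lte_fin ltrDl.
  by exists 0; exact: ltNyr.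
have [V [N1 _ VN1] VM] := limf_esup_lt supM.
(* The limit of the quotients is below [+oo], so they are eventually finite and their points lie in
   [A]. *)
have [N2 _ N2A] : \forall k \near \oo, A (x + t k *: w_ k).
  have : nbhs d [set y | (y < +oo)%E].
    by apply: open_nbhs_nbhs; split => //; exact: open_ereal_lt_ereal.
  move=> /cq; rewrite /nbhs/=; apply: filterS => k.
  exact: diff_quotient2_indicator_out.
pose N := maxn N1 N2.
pose p_ k := (2 / t (k + N)%N) *: (w_ (k + N)%N - w).
have p_M k : `|p_ k| <= 2 * M.
  have tk := t0 (k + N)%N.
  rewrite /p_ normrZ gtr0_norm ?divr_gt0// mulrAC -mulrA ler_pM2l//.
  have : V (k + N)%N.
    by apply: VN1 => /=; rewrite (leq_trans (leq_maxl N1 N2))// leq_addl.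
  move=> /VM; rewrite lte_fin => /ltW; apply: le_trans.
  by rewrite ler_pM2r ?invr_gt0// norm_le_enorm.
have [s [p [sk cp]]] := bounded_subseq p_M.
pose t' k := t (s k + N)%N.
have sN k : (k <= s k + N)%N by rewrite (leq_trans (sk k))// leq_addr.
have t'0 k : 0 < t' k by exact: t0.
have wE k : w_ (s k + N)%N = w + (2^-1 * t' k) *: p_ (s k).
  rewrite /p_ scalerA -/(t' k) (_ : 2^-1 * t' k * (2 / t' k) = 1) ?scale1r.
    by rewrite addrC subrK.
  by field; rewrite gt_eqF.
have Ak k : A (x + t' k *: w_ (s k + N)%N).
  by apply: N2A => /=; rewrite (leq_trans (leq_maxr N1 N2))// leq_addl.
exists p.
  exists t', (fun k => p_ (s k)); split=> //; first exact: cvg_subseq ct.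
  by move=> k; rewrite parabolic_pointE -wE.
apply: (cvg_unique (@ereal_hausdorff R) (cvg_subseq sN cq)).
have -> : (fun k => diff_quotient2 (indicator A) x v (t (s k + N)%N) (w_ (s k + N)%N)) =
    (fun k => (- dot v (p_ (s k)))%:E).
  apply/funext => k; rewrite -/(t' k) diff_quotient2_indicator//.
  rewrite wE dotDr vw add0r dotZr; congr EFin.
  by field; rewrite gt_eqF.
apply: cvg_EFin; first exact: nearW.
by apply: cvgN; apply: cvg_dot cp; exact: cvg_cst.
Qed.

(** A second-order tangent comes with some step sizes only; the arc makes every sufficiently small
    sequence admissible, so that several tangents can share their steps. *)
Lemma parabolically_derivable_seq A x w : parabolically_derivable A x w ->
  forall p, second_order_tangent_set A x w p ->
  exists2 eps : R, 0 < eps & forall t : nat -> R,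
    (forall k, 0 < t k <= eps) -> t @ \oo --> (0 : R) ->
    exists2 u_ : nat -> 'rV[R]_n, u_ @ \oo --> p &
      forall k, A (x + t k *: w + (2^-1 * t k ^+ 2) *: u_ k).
Proof.
move=> [_ der] p /der[eps eps0 [xi [xiA xi0 _ cxi]]].
exists eps => // t teps ct.
have t0 k : 0 < t k by case/andP: (teps k).
exists (fun k => (2^-1 * t k ^+ 2)^-1 *: (xi (t k) - xi 0 - t k *: w)).
  apply: cvg_comp cxi; exact: cvg_right0.
move=> k; rewrite scalerA divff ?scale1r; last first.
  by rewrite gt_eqF// mulr_gt0 ?exprn_gt0.
have -> : x + t k *: w + (xi (t k) - xi 0 - t k *: w) = xi (t k).
  by rewrite xi0; apply/rowP => i; rewrite !mxE; ring.
by apply: xiA; rewrite ltW//=; case/andP: (teps k).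
Qed.

(** Two tangents are realized along the same steps, smaller than both arc lengths; the points of [A]
    are then combined step by step. *)
Lemma second_order_tangent_segments A x w : closed_under_segments A ->
  parabolically_derivable A x w ->
  closed_under_segments (second_order_tangent_set A x w).
Proof.
move=> cA der p q c c01 /(parabolically_derivable_seq der)[e1 e10 H1].
move=> /(parabolically_derivable_seq der)[e2 e20 H2].
pose t k : R := Num.min e1 e2 * k.+1%:R^-1.
have e0 : 0 < Num.min e1 e2 by rewrite lt_min e10.
have t0 k : 0 < t k by rewrite mulr_gt0// invr_gt0.
have tle k : t k <= Num.min e1 e2.
  by apply: ler_piMr; [exact: ltW|rewrite invf_le1// ler1n].
have ct : t @ \oo --> (0 : R).
  rewrite -(mulr0 (Num.min e1 e2)); apply: cvgM; first exact: cvg_cst.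
  exact: cvg_harmonic.
have [|u_ cu Au] := H1 t _ ct.
  by move=> k; rewrite t0/= (le_trans (tle k))// ge_min lexx.
have [|v_ cv Av] := H2 t _ ct.
  by move=> k; rewrite t0/= (le_trans (tle k))// ge_min lexx orbT.
exists t, (fun k => c *: u_ k + (1 - c) *: v_ k); split=> //.
  by apply: cvgD; apply: cvgZ => //; exact: cvg_cst.
move=> k; have := cA _ _ c c01 (Au k) (Av k); congr (A _).
by apply/rowP => i; rewrite !mxE; ring.
Qed.

(* The convex combination with weight [s t^2/2] of a point of [A] near
   [x + t w + t^2/2 p] and of [y] moves the second-order term by [s (y - x)]. *)
Lemma second_order_tangent_recession A x w p y (s : R) : closed_under_segments A ->
  second_order_tangent_set A x w p -> A y -> 0 <= s ->
  second_order_tangent_set A x w (p + s *: (y - x)).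
Proof.
move=> cA [t [u_ [t0 ct cu Au]]] Ay s0.
pose z k := x + t k *: w + (2^-1 * t k ^+ 2) *: u_ k.
have ct2 : (fun k => 2^-1 * t k ^+ 2) @ \oo --> (0 : R).
  rewrite -(mulr0 2^-1); apply: cvgM; first exact: cvg_cst.
  rewrite -(mulr0 (0 : R)); under eq_fun do rewrite expr2; exact: cvgM.
have cz : z @ \oo --> x.
  rewrite -[X in _ --> X]addr0; apply: cvgD; last exact: cvg_scale0 cu.
  rewrite -[X in _ --> X]addr0; apply: cvgD; first exact: cvg_cst.
  exact: (cvg_scale0 ct (cvg_cst w)).
apply: (@second_order_tangent_near A x w _ t (fun k => u_ k + s *: (y - z k))) => //.
  apply: cvgD => //; apply: cvgZ; first exact: cvg_cst.
  by apply: cvgB => //; exact: cvg_cst.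
have cst2 : (fun k => 2^-1 * t k ^+ 2 * s) @ \oo --> (0 : R).
  by rewrite -(mul0r s); apply: cvgM => //; exact: cvg_cst.
near=> k.
have k1 : 2^-1 * t k ^+ 2 * s <= 1 by near: k; exact: (cvgr_le _ cst2 _ ltr01).
have k0 : 0 <= 2^-1 * t k ^+ 2 * s by rewrite mulr_ge0// mulr_ge0 ?sqr_ge0.
have := cA y (z k) (2^-1 * t k ^+ 2 * s) _ Ay (Au k).
rewrite k0 k1 => /(_ isT); congr (A _).
by rewrite /z; apply/rowP => i; rewrite !mxE; ring.
Unshelve. all: by end_near. Qed.

End SecondSubderivative.

Lemma diff_seq (R : realType) (V W : normedModType R) (f : V -> W) x u
    (t : nat -> R) (u_ : nat -> V) :
  differentiable f x -> (forall k, 0 < t k) -> t @ \oo --> (0 : R) ->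
  u_ @ \oo --> u ->
  (fun k => (t k)^-1 *: (f (x + t k *: u_ k) - f x)) @ \oo --> 'd f x u.
Proof.
move=> df t0 ct cu.
have cD : (fun k => 'd f x (u_ k)) @ \oo --> 'd f x u.
  by apply: (continuous_cvg _ _ cu); exact: diff_continuous.
rewrite -[X in _ --> X]add0r.
set Q := fun k => _; set D := fun k => 'd f x (u_ k) in cD.
have -> : Q = (Q \- D) \+ D by apply/funext => k /=; rewrite subrK.
apply: cvgD cD; apply/cvgr0Pnorm_le => e e0.
have M0 : 0 < `|u| + 1 by rewrite ltr_wpDl.
have H := diff_bound df (divr_gt0 e0 M0).
have {}H := cvg_scale0 ct cu H.
near=> k.
have uM : `|u_ k| <= `|u| + 1 by near: k; exact: cvg_bounded_norm.
have : `|f (x + t k *: u_ k) - f x - 'd f x (t k *: u_ k)| <=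
    e / (`|u| + 1) * `|t k *: u_ k| by near: k.
rewrite ['d f x (t k *: _)]linearZ /= normrZ (gtr0_norm (t0 k)) => h.
have -> : Q k - D k = (t k)^-1 *: (f (x + t k *: u_ k) - f x - t k *: 'd f x (u_ k)).
  by rewrite [in RHS]scalerBr scalerA mulVf ?scale1r// gt_eqF.
rewrite normrZ normfV (gtr0_norm (t0 k)) mulrC ler_pdivrMr//.
apply: le_trans h _; rewrite mulrCA mulrC ler_pM2r// mulrAC ler_pdivrMr//.
by rewrite ler_pM2l.
Unshelve. all: by end_near. Qed.

(** Replaces the distances, which are Euclidean infima, by a near-projection with slack [eta] in the
    sup norm; no nearest point has to exist. The infimum over the feasible set is genuine because
    [xbar] is feasible. *)
Lemma metric_subregularity_approx (R : realType) (n m : nat)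
    (f : 'rV[R]_n -> 'rV[R]_m) (Theta : set 'rV[R]_m) (xbar : 'rV[R]_n) :
  metric_subregularity_condition f Theta xbar -> Theta (f xbar) ->
  exists2 kappa : R, 0 < kappa & \forall x \near xbar, forall y eta,
    Theta y -> 0 < eta -> exists2 x', feasible_set f Theta x' &
      `|x - x'| <= kappa * `|f x - y| + eta.
Proof.
move=> [kappa k0 sub] fx; exists (kappa * m.+1%:R); first by rewrite mulr_gt0.
apply: filterS sub => x hx y eta Ty eta0.
have infE : has_inf [set enorm (x - y) | y in feasible_set f Theta].
  split; first by exists (enorm (x - xbar)), xbar.
  by exists 0 => _ [z _ <-]; exact: enorm_ge0.
have [_ [x' Ox' <-] lt_x'] := inf_adherent eta0 infE.
exists x' => //; apply: le_trans (norm_le_enorm _) _.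
apply: le_trans (ltW lt_x') _; rewrite lerD2r; apply: le_trans hx _.
rewrite -mulrA ler_pM2l//; apply: le_trans (enorm_le_norm _).
apply: ge_inf; last by exists y.
by exists 0 => _ [z _ <-]; exact: enorm_ge0.
Qed.

(** * Second-order calculus of the Lagrangian *)

Section Calculus.
Context {R : realType}.

Lemma linear_mx_continuous (k l : nat) (V : normedModType R)
    (g : {linear 'M[R]_(k, l) -> V}) : continuous g.
Proof.
have gE : (g : _ -> _) = fun M => \sum_i \sum_j M i j *: g (delta_mx i j).
  apply/funext => M; rewrite {1}(matrix_sum_delta M) linear_sum; apply: eq_bigr => i _.
  by rewrite linear_sum; apply: eq_bigr => j _; rewrite linearZ.
rewrite gE; apply: continuous_big => [|i _]; first exact: add_continuous.
apply: continuous_big => [|j _]; first exact: add_continuous.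
move=> M; exact: (cvgZ (@coord_continuous _ _ _ i j M) (cvg_cst _)).
Qed.

Lemma diff_linear_mx (k l : nat) (U V : normedModType R)
    (g : 'M[R]_(k, l) -> V) (h : U -> 'M[R]_(k, l)) x :
  linear g -> differentiable h x ->
  differentiable (g \o h) x /\ 'd (g \o h) x = g \o 'd h x :> (U -> V).
Proof.
move=> lg dh.
pose gM := GRing.isLinear.Build _ _ _ _ _ lg.
pose gL : {linear 'M[R]_(k, l) -> V} := HB.pack g gM.
have cg : continuous gL by exact: linear_mx_continuous.
have dg' : differentiable gL (h x) by apply: linear_differentiable.
have dg : differentiable g (h x) by exact: dg'.
split; first exact: differentiable_comp.
by rewrite diff_comp//; rewrite (_ : ('d g (h x) : _ -> _) = g)//; exact: (diff_lin (h x) cg).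
Qed.

(** Needed because the gradient of the Lagrangian has its explicit formula only near [xbar]. *)
Lemma near_eq_diff (V W : normedModType R) (f g : V -> W) (x : V) :
  (\forall y \near x, f y = g y) -> differentiable g x ->
  differentiable f x /\ 'd f x = 'd g x :> (V -> W).
Proof.
move=> fg dg; have fgx : f x = g x by exact: (nbhs_singleton fg).
have df : f \o shift x = cst (f x) + 'd g x +o_ (0 : V) id.
  apply/eqaddoP => e e0; have /eqaddoP/(_ _ e0) := diff_locally dg.
  have fg0 : \forall h \near (0 : V), f (h + x) = g (h + x).
    by move/nbhs0P : fg; apply: filterS => h; rewrite addrC.
  move=> H; near=> h.
  have : `|(g \o shift x - (cst (g x) + 'd g x)) h| <= e * `|id h| by near: h.
  rewrite !fctE /= fgx.
  by have -> : f (h + x) = g (h + x) by near: h.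
have E : 'd f x = 'd g x :> (V -> W).
  by apply: diff_unique; [exact: diff_continuous|exact: df].
split=> //; apply/diff_locallyP; rewrite E; split; [exact: diff_continuous|exact: df].
Unshelve. all: by end_near. Qed.

Lemma diff_jacobian (n m : nat) (f : 'rV[R]_n -> 'rV[R]_m) x h :
  differentiable f x -> 'd f x h = h *m jacobian f x.
Proof. by move=> df; rewrite -deriveEjacobian// deriveE. Qed.

(** Holds at every point, since ['d phi x] is a linear map by construction. *)
Lemma diff_grad (n : nat) (phi : 'rV[R]_n -> R) x h :
  'd phi x h = dot (grad phi x) h.
Proof.
rewrite {1}(row_sum_delta h) linear_sum; apply: eq_bigr => i _.
by rewrite linearZ mxE mulrC.
Qed.

Lemma dot_linear (n : nat) (lam : 'rV[R]_n) : linear (dot lam : 'rV[R]_n -> R^o).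
Proof. by move=> a u v; rewrite dotDr dotZr. Qed.

End Calculus.

Section LagrangianCalculus.
Context {R : realType} {n m : nat}.
Variables (phi : 'rV[R]_n -> R) (f : 'rV[R]_n -> 'rV[R]_m) (xbar : 'rV[R]_n).
Hypothesis phi2 : twice_differentiable phi xbar.
Hypothesis f2 : twice_differentiable_map f xbar.

Local Notation J := (jacobian f xbar).

(** The vector [f''(xbar)(w, w)]: the Jacobian is differentiated along [w] and then applied to
    [w]. *)
Definition second_derivative_map (w : 'rV[R]_n) : 'rV[R]_m :=
  w *m 'd (jacobian f) xbar w.

Local Notation H := second_derivative_map.

Lemma grad_dot (lam : 'rV[R]_m) y : differentiable f y ->
  differentiable (fun x => dot lam (f x)) y /\
  forall h, 'd (fun x => dot lam (f x)) y h = dot (lam *m (jacobian f y)^T) h.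
Proof.
move=> df; have [d1 dE] := diff_linear_mx (dot_linear lam) df.
split=> [|h]; first exact: d1.
have -> : 'd (fun x => dot lam (f x)) y h = dot lam ('d f y h).
  by have := congr1 (@^~ h) dE.
by rewrite diff_jacobian// (dotC lam) (dot_mulmx h) dotC.
Qed.

Lemma diff_mul_jacobian (lam : 'rV[R]_m) :
  differentiable (fun x => lam *m (jacobian f x)^T) xbar /\
  forall w, 'd (fun x => lam *m (jacobian f x)^T) xbar w =
    lam *m ('d (jacobian f) xbar w)^T.
Proof.
have lin : linear (fun M : 'M[R]_(n, m) => lam *m M^T).
  by move=> a M N; rewrite linearP /= mulmxDr -scalemxAr.
have [d1 dE] := diff_linear_mx lin f2.2.
split=> [|w]; [exact: d1|exact: (congr1 (@^~ w) dE)].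
Qed.

Lemma dot_second_derivative (lam : 'rV[R]_m) w :
  dot (lam *m ('d (jacobian f) xbar w)^T) w = dot lam (H w).
Proof. by rewrite dotC -dot_mulmx dotC. Qed.

Lemma hess_Lagrangian (lam : 'rV[R]_m) w :
  dot (w *m hess (fun x => Lagrangian phi f x lam) xbar) w =
  dot ('d (grad phi) xbar w) w + dot lam (H w).
Proof.
pose G := fun x => grad phi x + lam *m (jacobian f x)^T.
have [dl dlE] := diff_mul_jacobian lam.
have dG : differentiable G xbar by apply: differentiableD => //; exact: phi2.2.
have gradE : \forall y \near xbar, grad (fun x => Lagrangian phi f x lam) y = G y.
  apply: filterS (filterI phi2.1 f2.1) => y [dp df].
  have [d1 d1E] := grad_dot lam df.
  apply: dot_inj => h; rewrite -diff_grad /Lagrangian.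
  have -> : (fun x => phi x + dot lam (f x)) = phi + (fun x => dot lam (f x)) by [].
  by rewrite diffD// dotDl -d1E -diff_grad.
have [dg dgE] := near_eq_diff gradE dG.
have GE := congr1 (@^~ w) (diffD phi2.2 dl).
have E := etrans (esym (diff_jacobian w dg)) (etrans (congr1 (@^~ w) dgE) GE).
rewrite /hess [X in dot X w]E.
rewrite -dot_second_derivative -dotDl.
congr (dot (_ + _) w).
exact: dlE.
Qed.

Lemma taylor2_phi (t : nat -> R) (w_ : nat -> 'rV[R]_n) w :
  (forall k, 0 < t k) -> t @ \oo --> (0 : R) -> w_ @ \oo --> w ->
  (fun k => (2^-1 * t k ^+ 2)^-1 *
    (phi (xbar + t k *: w_ k) - phi xbar - t k * dot (grad phi xbar) (w_ k)))
    @ \oo --> dot ('d (grad phi) xbar w) w.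
Proof.
apply: taylor2_seq; last exact: phi2.2.
by apply: filterS phi2.1 => y dy; split=> // h; exact: diff_grad.
Qed.

Lemma taylor2_dot (lam : 'rV[R]_m) (t : nat -> R) (w_ : nat -> 'rV[R]_n) w :
  (forall k, 0 < t k) -> t @ \oo --> (0 : R) -> w_ @ \oo --> w ->
  (fun k => (2^-1 * t k ^+ 2)^-1 * (dot lam (f (xbar + t k *: w_ k)) -
     dot lam (f xbar) - t k * dot lam (w_ k *m J))) @ \oo --> dot lam (H w).
Proof.
move=> t0 ct cw; have [dl dlE] := diff_mul_jacobian lam.
rewrite -dot_second_derivative -dlE.
under eq_fun do rewrite [dot lam (_ *m J)]dotC dot_mulmx [dot _ (lam *m _)]dotC.
apply: (@taylor2_seq _ _ (fun x => dot lam (f x))) => //.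
by apply: filterS f2.1 => y; exact: grad_dot.
Qed.

Lemma taylor2_map (t : nat -> R) (w_ : nat -> 'rV[R]_n) w :
  (forall k, 0 < t k) -> t @ \oo --> (0 : R) -> w_ @ \oo --> w ->
  (fun k => (2^-1 * t k ^+ 2)^-1 *:
    (f (xbar + t k *: w_ k) - f xbar - t k *: (w_ k *m J))) @ \oo --> H w.
Proof.
move=> t0 ct cw; apply: mx_cvgP => i j; rewrite ord1.
have := taylor2_dot (lam := delta_mx 0 j) t0 ct cw.
under eq_fun do rewrite !(dotC (delta_mx 0 j)) !dot_delta.
rewrite (dotC (delta_mx 0 j)) dot_delta; apply: cvg_trans.
by apply: near_eq_cvg; apply: nearW => k; rewrite !mxE.
Qed.

(** This is [taylor2_phi] along the moving direction [w + t/2 u_]; its first-order part in [u_] is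
    of order [t^2] and contributes the gradient term. *)
Lemma parabolic_phi w u (t : nat -> R) (u_ : nat -> 'rV[R]_n) :
  (forall k, 0 < t k) -> t @ \oo --> (0 : R) -> u_ @ \oo --> u ->
  (fun k => (2^-1 * t k ^+ 2)^-1 *
    (phi (xbar + t k *: w + (2^-1 * t k ^+ 2) *: u_ k) - phi xbar
     - t k * dot (grad phi xbar) w)) @ \oo -->
  dot (grad phi xbar) u + dot ('d (grad phi) xbar w) w.
Proof.
move=> t0 ct cu.
have c1 := taylor2_phi t0 ct (cvg_parabolic (w := w) ct cu).
have c2 : (fun k => dot (grad phi xbar) (u_ k)) @ \oo --> dot (grad phi xbar) u.
  by apply: cvg_dot => //; exact: cvg_cst.
apply: cvg_trans (cvgD c2 c1); apply: near_eq_cvg; apply: nearW => k /=.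
rewrite !fctE /= parabolic_pointE dotDr dotZr; field.
by rewrite gt_eqF.
Qed.

Lemma parabolic_map w (u : 'rV[R]_n) (t : nat -> R) (u_ : nat -> 'rV[R]_n) :
  (forall k, 0 < t k) -> t @ \oo --> (0 : R) -> u_ @ \oo --> u ->
  (fun k => (2^-1 * t k ^+ 2)^-1 *:
    (f (xbar + t k *: w + (2^-1 * t k ^+ 2) *: u_ k) - f xbar
     - t k *: (w *m J))) @ \oo --> u *m J + H w.
Proof.
move=> t0 ct cu.
have c1 := taylor2_map t0 ct (cvg_parabolic (w := w) ct cu).
have c2 : (fun k => u_ k *m J) @ \oo --> u *m J.
  exact: (cvg_comp _ _ cu (linear_mx_continuous (g := mulmxr J) (x := u))).
apply: cvg_trans (cvgD c2 c1); apply: near_eq_cvg; apply: nearW => k /=.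
rewrite !fctE /= parabolic_pointE mulmxDl -scalemxAl.
apply/rowP => i; rewrite !mxE; field.
by rewrite gt_eqF.
Qed.

End LagrangianCalculus.

(** * Existence of multipliers *)

Section ConstraintSystem.
Context {R : realType} {n m : nat}.
Variables (f : 'rV[R]_n -> 'rV[R]_m) (Theta : set 'rV[R]_m).
Hypothesis Theta_segments : closed_under_segments Theta.

Local Notation Omega := (feasible_set f Theta).

Definition locally_subregular (kappa : R) (x : 'rV[R]_n) : Prop :=
  forall y eta, Theta y -> 0 < eta -> exists2 x', Omega x' &
    `|x - x'| <= kappa * `|f x - y| + eta.

Lemma convex_normal_tangent z lam (w : 'rV[R]_m) :
  (forall y, Theta y -> dot lam (y - z) <= 0) -> tangent_cone Theta z w ->
  dot lam w <= 0.
Proof.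
move=> lamN [t [w_ [t0 ct cw Tw]]].
apply: (cvgr_to_le (cvg_dot (cvg_cst lam) cw)).
apply: nearW => k; have := lamN _ (Tw k).
by rewrite addrAC subrr add0r dotZr pmulr_rle0.
Qed.

Lemma cvg_add_scale (V : normedModType R) (x : V) (t : nat -> R) (u_ : nat -> V) (u : V) :
  t @ \oo --> (0 : R) -> u_ @ \oo --> u -> (fun k => x + t k *: u_ k) @ \oo --> x.
Proof.
move=> ct cu; rewrite -[X in _ --> X]addr0; apply: cvgD (cvg_scale0 ct cu).
exact: cvg_cst.
Qed.

Lemma tangent_image x w : differentiable f x ->
  tangent_cone Omega x w -> tangent_cone Theta (f x) (w *m jacobian f x).
Proof.
move=> df [t [w_ [t0 ct cw Ow]]].
exists t, (fun k => (t k)^-1 *: (f (x + t k *: w_ k) - f x)); split=> //.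
  by rewrite -diff_jacobian//; exact: diff_seq.
move=> k; rewrite scalerA divff ?gt_eqF// scale1r addrC subrK.
exact: Ow.
Qed.

(** Near-projections of a whole sequence, shifted by [N] so that all its points lie in the
    neighborhood where subregularity holds. *)
Lemma subregular_seq kappa (x : 'rV[R]_n) (p : nat -> 'rV[R]_n) (y : nat -> 'rV[R]_m)
    (eta : nat -> R) :
  (\forall z \near x, locally_subregular kappa z) -> p @ \oo --> x ->
  (forall k, Theta (y k)) -> (forall k, 0 < eta k) ->
  exists (N : nat) (x' : nat -> 'rV[R]_n), forall k, Omega (x' k) /\
    `|p (k + N)%N - x' k| <=
      kappa * `|f (p (k + N)%N) - y (k + N)%N| + eta (k + N)%N.
Proof.
move=> sub cp Ty eta0; have [N _ HN] := cp _ sub; exists N.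
have ex k : exists z, Omega z /\ `|p (k + N)%N - z| <=
    kappa * `|f (p (k + N)%N) - y (k + N)%N| + eta (k + N)%N.
  have [x' Ox' hx'] := HN _ (leq_addl k N) _ _ (Ty (k + N)%N) (eta0 (k + N)%N).
  by exists x'.
by have [x' x'P] := choice ex; exists x'.
Qed.

(** Near-projecting [x + h u] onto the feasible set, with [h y + (1 - h) f x] as comparison point of
    [Theta], produces a tangent [u1] with [|u1 - u|] at most [kappa |u J - (y - f x)|], where [J] is
    the Jacobian at [x]. Since [<v, u1> <= 0], only [<v, u - u1>] has to be bounded. *)
Lemma regular_normal_estimate kappa x v : 0 < kappa -> Omega x ->
  differentiable f x -> (\forall y \near x, locally_subregular kappa y) ->
  regular_normal_cone Omega x v -> forall u y, Theta y ->
  dot v u <= n%:R * (`|v| * kappa) * `|u *m jacobian f x - (y - f x)|.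
Proof.
move=> k0 Ox df sub vN u y Ty.
pose h k : R := k.+1%:R^-1.
have h0 k : 0 < h k by rewrite invr_gt0.
have h1 k : h k <= 1 by rewrite invf_le1// ler1n.
have ch : h @ \oo --> (0 : R) by exact: cvg_harmonic.
(* The slack [h^2] is negligible against the step [h]. *)
have [N [x' x'P]] := @subregular_seq kappa x (fun k => x + h k *: u)
  (fun k => h k *: y + (1 - h k) *: f x) (fun k => h k * h k) sub
  (cvg_add_scale ch (cvg_cst u))
  (fun k => Theta_segments (introT andP (conj (ltW (h0 k)) (h1 k))) Ty Ox)
  (fun k => mulr_gt0 (h0 k) (h0 k)).
pose t k := h (k + N)%N.
have t0 k : 0 < t k by exact: h0.
have ct : t @ \oo --> (0 : R) by rewrite /t cvg_shiftn.
pose u' k := (t k)^-1 *: (x' k - x).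
have x'E k : x + t k *: u' k = x' k.
  by rewrite /u' scalerA divff ?gt_eqF// scale1r addrC subrK.
pose q k := (t k)^-1 *: (f (x + t k *: u) - f x) - (y - f x).
have cq : q @ \oo --> u *m jacobian f x - (y - f x).
  apply: cvgB; last exact: cvg_cst.
  by rewrite -diff_jacobian//; apply: diff_seq => //; exact: cvg_cst.
have u'q k : `|u' k - u| <= kappa * `|q k| + t k.
  have [_ hx] := x'P k; have tk := t0 k.
  have e1 : `|x + t k *: u - x' k| = t k * `|u' k - u|.
    rewrite -[X in _ = X * _](gtr0_norm tk) -normrZ distrC -x'E; congr `|_|.
    by apply/rowP => i; rewrite !mxE; ring.
  have e2 : `|f (x + t k *: u) - (t k *: y + (1 - t k) *: f x)| = t k * `|q k|.
    rewrite -[X in _ = X * _](gtr0_norm tk) -normrZ; congr `|_|.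
    rewrite /q scalerBr scalerA divff ?gt_eqF// scale1r.
    by apply/rowP => i; rewrite !mxE; ring.
  move: hx; rewrite -/(t k) e1 e2 mulrCA -mulrDr ler_pM2l//.
have cqn : (fun k => kappa * `|q k| + t k) @ \oo -->
    kappa * `|u *m jacobian f x - (y - f x)| + 0.
  by apply: cvgD => //; apply: cvgM; [exact: cvg_cst|exact: cvg_norm].
have [M [Mreal HM]] := cvg_seq_bounded (cvgP _ cqn).
have u'M k : `|u' k| <= M + 1 + `|u|.
  rewrite -lerBlDr; apply: le_trans (lerB_dist _ _) _; apply: le_trans (u'q k) _.
  by apply: le_trans (ler_norm _) _; apply: HM; rewrite ?ltrDl.
have [s [u1 [sk cu1]]] := bounded_subseq u'M.
have u1T : tangent_cone Omega x u1.
  exists (fun k => t (s k)), (fun k => u' (s k)); split=> //.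
    exact: cvg_subseq ct.
  by move=> k; rewrite x'E; case: (x'P (s k)).
have vu1 := regular_normal_tangent vN u1T.
have u1u : `|u1 - u| <= kappa * `|u *m jacobian f x - (y - f x)|.
  rewrite -[leRHS]addr0 -subr_le0.
  have c1 : (fun k => `|u' (s k) - u| - (kappa * `|q (s k)| + t (s k))) @ \oo -->
      `|u1 - u| - (kappa * `|u *m jacobian f x - (y - f x)| + 0).
    apply: cvgB; last exact: (cvg_subseq sk cqn).
    by apply: cvg_norm; apply: cvgB => //; exact: cvg_cst.
  by apply: (cvgr_to_le c1); apply: nearW => k; rewrite subr_le0.
have vu : dot v u <= dot v (u - u1) by rewrite dotBr lerDl oppr_ge0.
apply: le_trans vu _; apply: le_trans (ler_dot _ _) _.
by rewrite -!mulrA ler_wpM2l// ler_wpM2l// distrC.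
Qed.

(** The estimate above is the hypothesis of [dual_multiplier] for [Theta] translated by [- f x],
    with [a] and [b] zero. Its penalty constant becomes the norm bound, which depends on [x] only
    through [v]. *)
Lemma regular_normal_multiplier kappa x v : 0 < kappa -> Omega x ->
  differentiable f x -> (\forall y \near x, locally_subregular kappa y) ->
  regular_normal_cone Omega x v ->
  exists lam : 'rV[R]_m, [/\ lam *m (jacobian f x)^T = v,
    forall y, Theta y -> dot lam (y - f x) <= 0 &
    `|lam| <= n%:R * (`|v| * kappa)].
Proof.
move=> k0 Ox df sub vN.
pose S := [set p | Theta (p + f x)].
have c0 : 0 <= n%:R * (`|v| * kappa) by rewrite !mulr_ge0// ltW.
have [|||lam [lamv lamS lamc]] :=
    @dual_multiplier R n m S (jacobian f x) 0 v 0 _ c0.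
- move=> p q t t01 Sp Sq; have := Theta_segments t01 Sp Sq; rewrite /S /=.
  by congr (Theta _); apply/rowP => i; rewrite !mxE; ring.
- by exists 0; rewrite /S /= add0r.
- move=> u p Sp; rewrite subr0 add0r.
  have := regular_normal_estimate k0 Ox df sub vN u Sp.
  by rewrite addrK.
exists lam; split=> //.
  move=> y Ty; have := lamS (y - f x); rewrite dot0r addr0; apply.
  by rewrite /S /= subrK.
exact: norm_le_dot.
Qed.

(* Multipliers of the regular normals [v_ k] at nearby points are bounded by
   [n kappa |v_ k|], so a subsequence converges to a multiplier of the limit. *)
Lemma multiplier_exists x v : twice_differentiable_map f x -> Omega x ->
  metric_subregularity_condition f Theta x -> normal_cone Omega x v ->
  exists lam, multipliers f Theta x v lam.
Proof.
move=> [fd Jd] Ox sub [x_ [v_ [cx Ox_ cv vN]]].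
have [kappa k0 near_sub] := metric_subregularity_approx sub Ox.
(* The regular normals live at the points [x_ k], so subregularity is needed around each of them and
   not only around [x]. *)
have good : \forall y \near x, differentiable f y /\
    \forall z \near y, locally_subregular kappa z.
  exact: (filterI fd (near_join near_sub)).
have [N1 _ HN1] := cx _ good.
have [N2 _ HN2] := cvg_bounded_norm cv.
pose N := maxn N1 N2.
have ex k : exists lam : 'rV[R]_m,
    [/\ lam *m (jacobian f (x_ (k + N)%N))^T = v_ (k + N)%N,
    forall y, Theta y -> dot lam (y - f (x_ (k + N)%N)) <= 0 &
    `|lam| <= n%:R * ((`|v| + 1) * kappa)].
  have kN1 : (N1 <= k + N)%N by rewrite (leq_trans (leq_maxl N1 N2))// leq_addl.
  have kN2 : (N2 <= k + N)%N by rewrite (leq_trans (leq_maxr N1 N2))// leq_addl.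
  have [dfk subk] := HN1 _ kN1.
  have [lam [h1 h2 h3]] := regular_normal_multiplier k0 (Ox_ _) dfk subk (vN _).
  exists lam; split=> //; apply: le_trans h3 _.
  by apply: ler_wpM2l => //; apply: ler_wpM2r; [exact: ltW|exact: HN2].
have [lam_ lamP] := choice ex.
have [s [lam [sk clam]]] := @bounded_subseq _ _ lam_ _ (fun k => let: And3 _ _ h := lamP k in h).
pose r k := (s k + N)%N.
have rk k : (k <= r k)%N by rewrite (leq_trans (sk k))// leq_addr.
have cxr : (fun k => x_ (r k)) @ \oo --> x by exact: cvg_subseq cx.
have cvr : (fun k => v_ (r k)) @ \oo --> v by exact: cvg_subseq cv.
have cf : (fun k => f (x_ (r k))) @ \oo --> f x.
  apply: (continuous_cvg _ _ cxr); apply: differentiable_continuous.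
  exact: (nbhs_singleton fd).
have cJ (h : 'rV[R]_n) : (fun k => h *m jacobian f (x_ (r k))) @ \oo --> h *m jacobian f x.
  have c1 : (fun k => jacobian f (x_ (r k))) @ \oo --> jacobian f x.
    by apply: (continuous_cvg _ _ cxr); exact: differentiable_continuous.
  exact: (cvg_comp _ _ c1 (linear_mx_continuous (g := mulmx h) (x := jacobian f x))).
exists lam; split.
  apply/convex_normal_coneP => // y Ty.
  have c1 : (fun k => y - f (x_ (r k))) @ \oo --> y - f x.
    by apply: cvgB => //; exact: cvg_cst.
  apply: (cvgr_to_le (cvg_dot clam c1)); apply: nearW => k.
  by have [_ h _] := lamP (s k); exact: h.
apply: dot_inj => h; rewrite dotC -dot_mulmx.
have c1 : (fun k => dot (h *m jacobian f (x_ (r k))) (lam_ (s k))) @ \oo -->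
    dot (h *m jacobian f x) lam by exact: cvg_dot.
have c2 : (fun k => dot (h *m jacobian f (x_ (r k))) (lam_ (s k))) @ \oo --> dot v h.
  apply: cvg_trans (cvg_dot cvr (cvg_cst h)); apply: near_eq_cvg; apply: nearW => k /=.
  by have [<- _ _] := lamP (s k); rewrite dotC -dot_mulmx.
exact: (cvg_unique (@Rhausdorff R) c1 c2).
Qed.

End ConstraintSystem.

(** * Second-order duality *)

Section SecondOrder.
Context {R : realType} {n m : nat}.
Variables (phi : 'rV[R]_n -> R) (f : 'rV[R]_n -> 'rV[R]_m) (Theta : set 'rV[R]_m).
Variables (xbar vbar : 'rV[R]_n).
Hypothesis Theta_segments : closed_under_segments Theta.
Hypothesis xbar_feasible : Theta (f xbar).
Hypothesis phi_diff2 : twice_differentiable phi xbar.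
Hypothesis f_diff2 : twice_differentiable_map f xbar.
Hypothesis vbarE : vbar = - grad phi xbar.

Local Notation Omega := (feasible_set f Theta).
Local Notation J := (jacobian f xbar).
Local Notation H := (second_derivative_map f xbar).
Local Notation Lambda := (multipliers f Theta xbar vbar).
Local Notation T2Omega := (second_order_tangent_set Omega xbar).
Local Notation T2Theta w := (second_order_tangent_set Theta (f xbar) (w *m J)).
Local Notation Q w := (dot ('d (grad phi) xbar w) w).
Local Notation term := (second_order_term phi f Theta xbar).

Lemma multiplier_dot lam u : Lambda lam -> dot lam (u *m J) = dot vbar u.
Proof. by move=> [_ <-]; rewrite (dotC lam) (dot_mulmx u) dotC. Qed.

Lemma multiplier_normal lam y : Lambda lam -> Theta y -> dot lam (y - f xbar) <= 0.
Proof. by case=> /(convex_normal_coneP _ Theta_segments xbar_feasible) + _; apply. Qed.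

Lemma f_diff : differentiable f xbar.
Proof. exact: nbhs_singleton f_diff2.1. Qed.

Lemma second_order_tangent_image w u : T2Omega w u -> T2Theta w (u *m J + H w).
Proof.
move=> [t [u_ [t0 ct cu Ou]]].
exists t; eexists; split=> //; first exact: (parabolic_map f_diff2 (w := w) t0 ct cu).
move=> k /=; rewrite scalerA divff ?scale1r; last first.
  by rewrite gt_eqF// mulr_gt0 ?exprn_gt0.
set y := f (_ + _); have -> : f xbar + t k *: (w *m J) + (y - f xbar - t k *: (w *m J)) = y.
  by apply/rowP => i; rewrite !mxE; ring.
exact: Ou.
Qed.

(** The image of [xbar + h w + h^2/2 u] differs from an arc in [Theta] with second-order part [p] by
    about [h^2/2 (u J + H w - p)]. Subregularity moves the point into the feasible set by a
    displacement of the same order; after rescaling, a subsequence converges to the required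
    tangent. *)
Lemma second_order_tangent_estimate kappa w u p : 0 < kappa ->
  (\forall x \near xbar, locally_subregular f Theta kappa x) ->
  parabolically_derivable Theta (f xbar) (w *m J) -> T2Theta w p ->
  exists2 u', T2Omega w u' & `|u' - u| <= kappa * `|u *m J + H w - p|.
Proof.
move=> k0 sub der /(parabolically_derivable_seq der)[e e0 arc].
pose h k : R := e * k.+1%:R^-1.
have h0 k : 0 < h k by rewrite mulr_gt0// invr_gt0.
have he k : 0 < h k <= e.
  rewrite h0 /=; apply: ler_piMr; first exact: ltW.
  by rewrite invf_le1// ler1n.
have ch : h @ \oo --> (0 : R).
  by rewrite -(mulr0 e); apply: cvgM; [exact: cvg_cst|exact: cvg_harmonic].
have [p_ cp Tp] := arc h he ch.
pose x k := xbar + h k *: w + (2^-1 * h k ^+ 2) *: u.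
have cx : x @ \oo --> xbar.
  rewrite /x; under eq_fun do rewrite parabolic_pointE.
  by apply: (cvg_add_scale ch); exact: (cvg_parabolic ch (cvg_cst u)).
(* The slack is of third order: divided by [h^2/2] it leaves [h], which vanishes. *)
have eta0 k : 0 < 2^-1 * h k ^+ 2 * h k by rewrite !mulr_gt0 ?exprn_gt0.
have [N [x' x'P]] := subregular_seq sub cx Tp eta0.
pose t k := h (k + N)%N.
pose s k := 2^-1 * t k ^+ 2.
have t0 k : 0 < t k by exact: h0.
have s0 k : 0 < s k by rewrite mulr_gt0 ?exprn_gt0.
have sN0 k : s k != 0 by rewrite gt_eqF.
have ct : t @ \oo --> (0 : R) by rewrite /t cvg_shiftn.
pose u' k := (s k)^-1 *: (x' k - xbar - t k *: w).
have x'E k : xbar + t k *: w + s k *: u' k = x' k.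
  rewrite /u' scalerA divff// scale1r.
  by apply/rowP => i; rewrite !mxE; ring.
pose q k := (s k)^-1 *: (f (x (k + N)%N) - f xbar - t k *: (w *m J)) - p_ (k + N)%N.
have cq : q @ \oo --> u *m J + H w - p.
  apply: cvgB; last by apply: cvg_subseq cp => k; exact: leq_addr.
  exact: (parabolic_map f_diff2 (w := w) t0 ct (cvg_cst u)).
have u'q k : `|u' k - u| <= kappa * `|q k| + t k.
  have [_ hx] := x'P k; have sk := s0 k.
  have e1 : `|x (k + N)%N - x' k| = s k * `|u' k - u|.
    rewrite -[X in _ = X * _](gtr0_norm sk) -normrZ distrC -x'E; congr `|_|.
    by rewrite /x -/(t k) -/(s k); apply/rowP => i; rewrite !mxE; ring.
  have e2 : `|f (x (k + N)%N) - (f xbar + h (k + N)%N *: (w *m J) +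
      (2^-1 * h (k + N)%N ^+ 2) *: p_ (k + N)%N)| = s k * `|q k|.
    rewrite -[X in _ = X * _](gtr0_norm sk) -normrZ; congr `|_|.
    rewrite /q scalerBr scalerA divff// scale1r -/(t k) -/(s k).
    by apply/rowP => i; rewrite !mxE; ring.
  by move: hx; rewrite -/(t k) -/(s k) e1 e2 mulrCA -mulrDr ler_pM2l.
have cqn : (fun k => kappa * `|q k| + t k) @ \oo -->
    kappa * `|u *m J + H w - p| + 0.
  by apply: cvgD => //; apply: cvgM; [exact: cvg_cst|exact: cvg_norm].
have [M [Mreal HM]] := cvg_seq_bounded (cvgP _ cqn).
have u'M k : `|u' k| <= M + 1 + `|u|.
  rewrite -lerBlDr; apply: le_trans (lerB_dist _ _) _; apply: le_trans (u'q k) _.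
  by apply: le_trans (ler_norm _) _; apply: HM; rewrite ?ltrDl.
have [r [u1 [rk cu1]]] := bounded_subseq u'M.
exists u1.
  exists (fun k => t (r k)), (fun k => u' (r k)); split=> //.
    exact: cvg_subseq ct.
  by move=> k; rewrite -/(s (r k)) x'E; case: (x'P (r k)).
rewrite -[leRHS]addr0 -subr_le0.
have c1 : (fun k => `|u' (r k) - u| - (kappa * `|q (r k)| + t (r k))) @ \oo -->
    `|u1 - u| - (kappa * `|u *m J + H w - p| + 0).
  apply: cvgB; last exact: (cvg_subseq rk cqn).
  by apply: cvg_norm; apply: cvgB => //; exact: cvg_cst.
by apply: (cvgr_to_le c1); apply: nearW => k; rewrite subr_le0.
Qed.

Lemma critical_multiplier lam w : Lambda lam ->
  critical_cone Omega xbar vbar w -> critical_cone Theta (f xbar) lam (w *m J).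
Proof.
move=> Llam [Tw vw]; split; first exact: (tangent_image f_diff).
by rewrite /= (multiplier_dot _ Llam).
Qed.

(** No sign is imposed on [l]: zero covers local minimizers and positive values cover quadratic
    growth. The first-order term along [w] vanishes since [vbar] is minus the gradient. *)
Lemma second_order_growth (l : R) w u :
  (\forall x \near xbar, Omega x ->
     phi xbar + l / 2 * enorm (x - xbar) ^+ 2 <= phi x) ->
  dot vbar w = 0 -> T2Omega w u -> l * enorm w ^+ 2 <= Q w - dot vbar u.
Proof.
move=> growth vw [t [u_ [t0 ct cu Ou]]].
have gw : dot (grad phi xbar) w = 0 by apply: oppr_inj; rewrite oppr0 -dotNl -vbarE.
have c1 := parabolic_phi phi_diff2 (w := w) t0 ct cu.
have -> : Q w - dot vbar u = dot (grad phi xbar) u + Q w.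
  by rewrite vbarE dotNl opprK addrC.
pose w_ k := w + (2^-1 * t k) *: u_ k.
have cw : w_ @ \oo --> w by exact: cvg_parabolic cu.
have cx : (fun k => xbar + t k *: w_ k) @ \oo --> xbar by exact: cvg_add_scale cw.
rewrite -subr_ge0 sqr_enorm.
have c2 : (fun k => l * dot (w_ k) (w_ k)) @ \oo --> l * dot w w.
  by apply: cvgM; [exact: cvg_cst|exact: cvg_dot].
apply: (cvgr_to_ge (cvgB c1 c2)).
have growth' := cx _ growth.
near=> k.
have : Omega (xbar + t k *: w_ k) -> phi xbar +
    l / 2 * enorm (xbar + t k *: w_ k - xbar) ^+ 2 <= phi (xbar + t k *: w_ k).
  by near: k.
have := Ou k; rewrite parabolic_pointE => Ok /(_ Ok).
rewrite addrAC subrr add0r enormZ exprMn (gtr0_norm (t0 k)) sqr_enorm => hk.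
rewrite !fctE /= subr_ge0 gw mulr0 subr0 parabolic_pointE -/(w_ k).
rewrite ler_pdivlMl; last by rewrite mulr_gt0 ?exprn_gt0.
rewrite lerBrDl; apply: le_trans hk; rewrite lerD2l le_eqVlt; apply/orP; left.
by apply/eqP; field.
Unshelve. all: by end_near. Qed.

Lemma second_order_termE lam w :
  term w lam = ((Q w + dot lam (H w))%:E +
    second_subderivative (indicator Theta) (f xbar) lam (w *m J))%E.
Proof. by rewrite /second_order_term hess_Lagrangian. Qed.

(** The second-order tangents of [Theta] recede in every direction [y - f xbar], so a functional
    bounded above on them is nonpositive there, that is, normal. *)
Lemma multiplier_of_support (beta : R) lam w p : T2Theta w p ->
  (forall q, T2Theta w q -> dot lam q <= beta) ->
  lam *m J^T = vbar -> Lambda lam.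
Proof.
move=> Tp lamb lamv; split=> //.
apply/convex_normal_coneP => // y Ty.
rewrite leNgt; apply/negP => lt0.
(* Moving this far from [p] would raise the value of [lam] above [beta]. *)
have s0 : 0 <= (`|beta| + `|dot lam p| + 1) / dot lam (y - f xbar).
  by rewrite divr_ge0 ?addr_ge0// ltW.
have := lamb _ (second_order_tangent_recession Theta_segments Tp Ty s0).
rewrite dotDr dotZr divfK ?gt_eqF//.
have := ler_norm beta; have := ler_norm (- dot lam p); rewrite normrN; lra.
Qed.

(* Strong duality between [sup <vbar, u>] over the second-order tangents [u] to
   [Omega] and the maximum over multipliers: metric subregularity is an error
   bound that makes [kappa |vbar| dist] an exact penalty, so [dual_multiplier]
   applies. *)
Lemma second_order_max kappa w : 0 < kappa ->
  (\forall x \near xbar, locally_subregular f Theta kappa x) ->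
  (forall lam, Lambda lam -> parabolically_regular Theta (f xbar) lam) ->
  Lambda !=set0 -> critical_cone Omega xbar vbar w ->
  parabolically_derivable Theta (f xbar) (w *m J) ->
  exists lam V, [/\ Lambda lam, term w lam = V%:E,
    forall lam', Lambda lam' -> (term w lam' <= V%:E)%E &
    forall a, (forall u, T2Omega w u -> a <= Q w - dot vbar u) -> a <= V].
Proof.
move=> k0 sub reg [lam0 Llam0] crit der.
have [p0 Tp0] := der.1.
(* Only the existence of a second-order tangent of the feasible set is extracted here. *)
have [u0 Tu0 _] := second_order_tangent_estimate 0 k0 sub der Tp0.
have lamw lam : Lambda lam -> dot lam (w *m J) = 0.
  by move=> Llam; have [] := critical_multiplier Llam crit.
have ssdT lam p : Lambda lam -> T2Theta w p ->
    (second_subderivative (indicator Theta) (f xbar) lam (w *m J) <= (- dot lam p)%:E)%E.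
  by move=> Llam; apply: second_subderivative_le_tangent => //; exact: lamw.
have termE lam : Lambda lam -> exists2 p, T2Theta w p &
    term w lam = (Q w + dot lam (H w) - dot lam p)%:E.
  move=> Llam.
  have [|p Tp ssdE] := second_subderivative_regular xbar_feasible (lamw _ Llam) (reg _ Llam).
    exact: le_lt_trans (ssdT _ _ Llam Tp0) (ltry _).
  by exists p => //; rewrite second_order_termE ssdE.
(* Weak duality: the image [u J + H w] of a second-order tangent [u] is a competitor for the second
   subderivative. *)
have weak lam p u : Lambda lam -> term w lam = (Q w + dot lam (H w) - dot lam p)%:E ->
    T2Omega w u -> Q w + dot lam (H w) - dot lam p <= Q w - dot vbar u.
  move=> Llam tE Tu.
  have Tq := second_order_tangent_image Tu.
  have : (term w lam <= ((Q w + dot lam (H w))%:E + (- dot lam (u *m J + H w))%:E))%E.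
    by rewrite second_order_termE leeD2lE//; exact: ssdT.
  rewrite tE lee_fin dotDr (multiplier_dot _ Llam); lra.
pose E := [set dot vbar u | u in T2Omega w].
have E0 : E !=set0 by exists (dot vbar u0), u0.
have [q0 Tq0 t0E] := termE _ Llam0.
have Eub : has_ubound E.
  exists (- dot lam0 (H w) + dot lam0 q0) => _ [u Tu <-].
  by have := weak _ _ _ Llam0 t0E Tu; lra.
pose beta := sup E.
have Eb u : T2Omega w u -> dot vbar u <= beta by move=> Tu; apply: ub_le_sup => //; exists u.
have c0 : 0 <= n%:R * (`|vbar| * kappa) by rewrite !mulr_ge0// ltW.
have [|||lam [lamv lamS _]] := @dual_multiplier R n m (T2Theta w) J (H w) vbar beta _ c0.
- exact: second_order_tangent_segments.
- exact: der.1.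
(* Exact penalization: [u] is replaced by a true tangent [u'] at a cost of [n |vbar| |u - u'|]. *)
- move=> u p Tp.
  have [u' Tu' hu'] := second_order_tangent_estimate u k0 sub der Tp.
  have := Eb _ Tu'; have := ler_dot vbar (u - u'); rewrite dotBr.
  have : n%:R * (`|vbar| * `|u - u'|) <=
      n%:R * (`|vbar| * kappa) * `|H w + u *m J - p|.
    by rewrite -!mulrA ler_wpM2l// ler_wpM2l// distrC [H w + _]addrC.
  lra.
have Llam : Lambda lam by exact: (multiplier_of_support Tp0 lamS).
have [p Tp tE] := termE _ Llam.
exists lam, (Q w + dot lam (H w) - dot lam p).
(* The dual value at [lam] reaches the primal bound; with weak duality this gives both maximality
   and the lower bound on [V]. *)
have bV : Q w - beta <= Q w + dot lam (H w) - dot lam p by have := lamS _ Tp; lra.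
split=> // [lam' Llam'|a aP].
  have [p' Tp' tE'] := termE _ Llam'.
  rewrite tE' lee_fin; apply: le_trans bV.
  rewrite lerBrDl -lerBrDr; apply: ge_sup => // _ [u Tu <-].
  by have := weak _ _ _ Llam' tE' Tu; lra.
apply: le_trans bV; rewrite lerBrDl -lerBrDr; apply: ge_sup => // _ [u Tu <-].
by have := aP _ Tu; lra.
Qed.

(** * Quadratic growth from the second-order condition *)

Lemma objective_feasible x : Omega x -> objective phi f Theta x = (phi x)%:E.
Proof. by move=> Ox; rewrite /objective /indicator mem_set// adde0. Qed.

Lemma objective_infeasible x : ~ Omega x -> objective phi f Theta x = +oo%E.
Proof.
by move=> Ox; rewrite /objective /indicator ifF ?addey//; apply/negbTE/negP => /set_mem.
Qed.

(* A sequence violating growth with constants [1/k] has, after normalization, a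
   limit direction in the critical cone along which every multiplier has a
   nonpositive second-order term. *)
Lemma second_order_sufficiency : Lambda !=set0 ->
  (forall w, critical_cone Omega xbar vbar w -> w != 0 ->
     exists2 lam, Lambda lam & (0 < term w lam)%E) ->
  quadratic_growth phi f Theta xbar.
Proof.
move=> [lam0 Llam0] suff; apply: contrapT => ngrowth.
have ex k : exists x, [/\ Omega x, enorm (x - xbar) <= k.+1%:R^-1 &
    phi x < phi xbar + k.+1%:R^-1 / 2 * enorm (x - xbar) ^+ 2].
  apply: contrapT => nex; apply: ngrowth; exists k.+1%:R^-1, k.+1%:R^-1.
  split; rewrite ?invr_gt0// => x xk.
  rewrite (objective_feasible xbar_feasible).
  have [Ox|Ox] := pselect (Omega x); last by rewrite objective_infeasible// leey.
  rewrite objective_feasible// -EFinD lee_fin leNgt; apply/negP => lt_x.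
  by apply: nex; exists x.
have [x_ x_P] := choice ex.
pose d k := `|x_ k - xbar|.
have d0 k : 0 < d k.
  (* At [xbar] itself the strict violation of growth would read [phi xbar < phi xbar]. *)
  rewrite /d normr_gt0 subr_eq0; apply/eqP => xE.
  have [_ _] := x_P k; rewrite xE subrr /enorm dot0r sqrtr0 expr0n /= mulr0 addr0.
  by rewrite ltxx.
pose v_ k := (d k)^-1 *: (x_ k - xbar).
have v1 k : `|v_ k| = 1.
  by rewrite normrZ gtr0_norm ?invr_gt0// -/(d k) mulVf// gt_eqF.
have [s [w [sk cw]]] := @bounded_subseq _ _ v_ 1 (fun k => eq_ind_r (fun r => r <= 1) (lexx 1) (v1 k)).
pose t k := d (s k); pose w_ k := v_ (s k); pose e k : R := (s k).+1%:R^-1.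
have t0 k : 0 < t k by exact: d0.
have e0 k : 0 < e k by rewrite invr_gt0.
have ce : e @ \oo --> (0 : R) by exact: (cvg_subseq sk cvg_harmonic).
have ct : t @ \oo --> (0 : R).
  apply: (squeeze_cvgr _ (cvg_cst 0) ce); apply: nearW => k; rewrite ltW//=.
  by apply: le_trans (norm_le_enorm _) _; case: (x_P (s k)).
have xE k : xbar + t k *: w_ k = x_ (s k).
  by rewrite /w_ /v_ scalerA divff ?gt_eqF// scale1r addrC subrK.
have Ox k : Omega (xbar + t k *: w_ k) by rewrite xE; case: (x_P (s k)).
have phix k : phi (xbar + t k *: w_ k) - phi xbar <= 
    (2^-1 * t k ^+ 2) * (e k * dot (w_ k) (w_ k)).
  have [_ _] := x_P (s k); rewrite -xE addrAC subrr add0r sqr_enorm dotZl dotZr -/(e k).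
  move=> /ltW; rewrite -lerBlDl => /le_trans; apply.
  by rewrite le_eqVlt; apply/orP; left; apply/eqP; ring.
have w0 : w != 0.
  have c1 : (fun k => `|v_ (s k)|) @ \oo --> `|w| by exact: cvg_norm.
  have c2 : (fun k => `|v_ (s k)|) @ \oo --> (1 : R).
    by under eq_fun do rewrite v1; exact: cvg_cst.
  have := cvg_unique (@Rhausdorff R) c1 c2.
  by move=> w1; rewrite -normr_gt0 w1.
have cww : (fun k => e k * dot (w_ k) (w_ k)) @ \oo --> 0 * dot w w.
  by apply: cvgM => //; exact: cvg_dot.
have Tw : tangent_cone Omega xbar w by exists t, w_.
(* One inequality holds because [w J] is tangent to [Theta] and [lam0] is normal to it; the other
   because [phi] increases by at most [o(t)] along the sequence. *)
have vw : dot vbar w = 0.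
  apply/eqP; rewrite eq_le; apply/andP; split.
    rewrite -(multiplier_dot _ Llam0).
    apply: (@convex_normal_tangent _ _ Theta (f xbar)); last exact: (tangent_image f_diff).
    by move=> y; exact: multiplier_normal.
  rewrite vbarE dotNl oppr_ge0 -diff_grad.
  have c1 := diff_seq (nbhs_singleton phi_diff2.1) t0 ct cw.
  have c2 : (fun k => 2^-1 * t k * (e k * dot (w_ k) (w_ k))) @ \oo -->
      2^-1 * 0 * (0 * dot w w).
    by apply: cvgM => //; apply: cvgM => //; exact: cvg_cst.
  have -> : 0 = 2^-1 * 0 * (0 * dot w w) :> R by rewrite mulr0 mul0r.
  rewrite -subr_le0; apply: (cvgr_to_le (cvgB c1 c2)); apply: nearW => k.
  rewrite !fctE /= subr_le0 [_ *: _]mulrC ler_pdivrMr//; apply: le_trans (phix k) _.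
  by rewrite le_eqVlt; apply/orP; left; apply/eqP; ring.
have [lam Llam] := suff w (conj Tw vw) w0; apply/negP; rewrite -leNgt.
rewrite second_order_termE.
pose a k := (2^-1 * t k ^+ 2)^-1 *
  (phi (xbar + t k *: w_ k) - phi xbar - t k * dot (grad phi xbar) (w_ k)).
pose b k := (2^-1 * t k ^+ 2)^-1 * (dot lam (f (xbar + t k *: w_ k)) -
  dot lam (f xbar) - t k * dot lam (w_ k *m J)).
have ca : a @ \oo --> Q w by exact: taylor2_phi.
have cb : b @ \oo --> dot lam (H w) by exact: taylor2_dot.
pose om k := (t k)^-1 *: (f (xbar + t k *: w_ k) - f xbar).
have com : om @ \oo --> w *m J.
  by rewrite -diff_jacobian; [exact: (diff_seq f_diff)|exact: f_diff].
have omE k : f xbar + t k *: om k = f (xbar + t k *: w_ k).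
  by rewrite scalerA divff ?gt_eqF// scale1r addrC subrK.
(* As [lam] satisfies the multiplier equation, the first-order terms of [phi] and of [<lam, f>]
   cancel, and the violated growth bounds the difference quotient along [om]. *)
have : (second_subderivative (indicator Theta) (f xbar) lam (w *m J) <=
    (0 * dot w w - (Q w + dot lam (H w)))%:E)%E.
  apply: (@second_subderivative_le _ _ _ _ _ _ t om
    (fun k => e k * dot (w_ k) (w_ k) - (a k + b k))) => //; last first.
    by apply: cvgB => //; exact: cvgD.
  apply: nearW => k; rewrite diff_quotient2_indicator//; last by rewrite omE; exact: Ox.
  rewrite lee_fin /a /b (multiplier_dot _ Llam) vbarE dotNl.
  have -> : t k * dot lam (om k) = dot lam (f (xbar + t k *: w_ k)) - dot lam (f xbar).
    by rewrite -dotZr -dotBr -omE [in RHS]addrC addKr.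
  have s0 : 0 < 2^-1 * t k ^+ 2 by rewrite mulr_gt0 ?exprn_gt0.
  rewrite ler_pdivrMr// -mulrDr mulrC mulrBr mulVKf ?gt_eqF//.
  by have := phix k; lra.
case: (second_subderivative _ _ _ _) => [r| |]; rewrite ?leye_eq//.
  by rewrite -EFinD !lee_fin mul0r; lra.
by rewrite addeNy leNye.
Qed.

End SecondOrder.

(** * Necessary and sufficient second-order conditions *)

Theorem theorem7p1 (R : realType) (n m : nat)
    (phi : 'rV[R]_n -> R) (f : 'rV[R]_n -> 'rV[R]_m)
    (Theta : set 'rV[R]_m) (xbar vbar : 'rV[R]_n)
    (Theta_closed : closed Theta)
    (Theta_convex : @convex_set R 'rV[R]_m Theta)
    (xbar_feasible : Theta (f xbar))
    (phi_diff2 : twice_differentiable phi xbar)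
    (f_diff2 : twice_differentiable_map f xbar)
    (vbarE : vbar = - grad phi xbar)
    (vbar_normal : normal_cone (feasible_set f Theta) xbar vbar)
    (mscq : metric_subregularity_condition f Theta xbar)
    (Theta_derivable : forall lam, multipliers f Theta xbar vbar lam ->
       forall w : 'rV[R]_n,
         critical_cone Theta (f xbar) lam (w *m jacobian f xbar) ->
         parabolically_derivable Theta (f xbar) (w *m jacobian f xbar))
    (Theta_regular : forall lam, multipliers f Theta xbar vbar lam ->
       parabolically_regular Theta (f xbar) lam) :
  let second_order_values (w : 'rV[R]_n) : set (\bar R) :=
    [set second_order_term phi f Theta xbar w lam
      | lam in multipliers f Theta xbar vbar] in
  let sufficient_condition : Prop :=
    forall w, critical_cone (feasible_set f Theta) xbar vbar w -> w != 0 ->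
      exists M, is_max (second_order_values w) M /\ (0 < M)%E in
  [/\ local_minimizer phi f Theta xbar ->
        forall w, critical_cone (feasible_set f Theta) xbar vbar w ->
          exists M, is_max (second_order_values w) M /\ (0 <= M)%E,
      sufficient_condition <-> quadratic_growth phi f Theta xbar &
      sufficient_condition -> strict_local_minimizer phi f Theta xbar].
Proof.
move=> values suff.
have Theta_seg := convex_set_segments Theta_convex.
have [kappa k0 sub] := metric_subregularity_approx mscq xbar_feasible.
have [lam0 Llam0] := multiplier_exists Theta_seg f_diff2 xbar_feasible mscq vbar_normal.
(* Both uses are served at once: the maximum is attained at a real value, and any growth constant
   [l], zero included, bounds it from below. *)
have maxP w : critical_cone (feasible_set f Theta) xbar vbar w ->
    exists V : R, is_max (values w) V%:E /\ forall l : R,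
      (\forall x \near xbar, feasible_set f Theta x ->
        phi xbar + l / 2 * enorm (x - xbar) ^+ 2 <= phi x) -> l * enorm w ^+ 2 <= V.
  move=> crit.
  have critT := critical_multiplier f_diff2 Llam0 crit.
  have [lam [V [Llam termE termle Vge]]] := second_order_max Theta_seg xbar_feasible
    phi_diff2 f_diff2 k0 sub Theta_regular (ex_intro _ _ Llam0) crit
    (Theta_derivable _ Llam0 _ critT).
  exists V; split.
    split; first by exists lam.
    by move=> _ [lam' Llam' <-]; exact: termle.
  move=> l growth; apply: Vge => u Tu.
  by apply: (second_order_growth phi_diff2 vbarE growth _ Tu); case: crit.
have sufficiency : suff -> quadratic_growth phi f Theta xbar.
  move=> sc; apply: (second_order_sufficiency Theta_seg xbar_feasible phi_diff2
    f_diff2 vbarE); first by exists lam0.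
  move=> w crit w0; have [_ [[[lam Llam <-] _] pos]] := sc w crit w0.
  by exists lam.
split.
- move=> [_ locmin] w crit; have [V [maxV Vge]] := maxP w crit.
  exists V%:E; split=> //; rewrite lee_fin -(mul0r (enorm w ^+ 2)); apply: Vge.
  by apply: filterS locmin => x h /h; rewrite !mul0r addr0.
- split=> // -[l [e [l0 e0 growth]]] w crit w0.
  have [V [maxV Vge]] := maxP w crit.
  exists V%:E; split=> //; rewrite lte_fin.
  apply: (@lt_le_trans _ _ (l * enorm w ^+ 2)); first by rewrite mulr_gt0// exprn_gt0// enorm_gt0.
  apply: Vge; have e'0 : 0 < e / n.+1%:R by rewrite divr_gt0.
  (* Neighborhoods use the sup norm and growth the Euclidean one, hence the smaller radius. *)
  apply/nbhs_normP; exists (e / n.+1%:R) => //= x; rewrite /ball_ /= distrC => xe Ox.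
  have := growth x; rewrite !objective_feasible// lee_fin; apply.
  apply: le_trans (enorm_le_norm _) _.
  by rewrite mulrC -ler_pdivlMr// ltW.
- move=> /sufficiency[l [e [l0 e0 growth]]]; split=> //.
  apply/nbhs_normP; exists (e / n.+1%:R); first by rewrite /= divr_gt0.
  move=> x; rewrite /ball_ /= distrC => xe Ox xx.
  have := growth x; rewrite !objective_feasible// lee_fin => H.
  apply: lt_le_trans (H _); last first.
    by apply: le_trans (enorm_le_norm _) _; rewrite mulrC -ler_pdivlMr// ltW.
  by rewrite ltrDl mulr_gt0 ?divr_gt0// exprn_gt0// enorm_gt0// subr_eq0.
Qed.
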